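(* In the non-strict model, the problem of deciding, given a directed temporal graph $\mathcal{G}$ and an integer $k$, whether $\mathcal{G}$ has a closed temporal connected component (closed TCC) of size at least $k$ is $\mathsf{W}[1]$-hard when parameterized by $k$, even if $\mathcal{G}$ has lifetime $3$. The same holds for the problem of deciding whether $\mathcal{G}$ has a closed temporal unilateral connected component (closed TUCC) of size at least $k$.
   Context: A directed temporal graph $\mathcal{G}=(G,\lambda)$ with lifetime $\tau$ consists of a finite directed graph $G$ together with a function $\lambda:E(G)\to 2^{[\tau]}$, where $[\tau]=\{1,\dots,\tau\}$; the edge $e$ is available (active) exactly at the times in $\lambda(e)$. In the non-strict model, a temporal $u,v$-path is a directed $u,v$-path in $G$ traversing consecutive edges $e_1,\dots,e_q$ together with times $t_1\le t_2\le\dots\le t_q$ such that $t_i\in\lambda(e_i)$ for every $i$ (the trivial path from a vertex to itself is allowed). A set $X\subseteq V(G)$ is a closed temporal connected set if for all $u,v\in X$ there are both a temporal $u,v$-path and a temporal $v,u$-path all of whose vertices lie in $X$; it is a closed temporal unilateral connected set if for all $u,v\in X$ there is a temporal $u,v$-path or a temporal $v,u$-path all of whose vertices lie in $X$. A closed TCC (resp. closed TUCC) is an inclusion-wise maximal closed temporal connected set (resp. closed temporal unilateral connected set); its size is its number of vertices. *)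

(* Defs.v *)
(* MathComp world. *)
From mathcomp Require Import all_boot.
Set Implicit Arguments.
Unset Strict Implicit.
Unset Printing Implicit Defensive.

(** * Computation

    The machine model is the one-variable WHILE language "I" of N. D. Jones
    (Computability and Complexity from a Programming Perspective), whose data
    are binary trees, extended with a conditional.  An assignment costs the
    full size of the stored value (there is no sharing) and a test costs 1, so
    running times are polynomially related to those of Turing machines. *)

Inductive data := Leaf | Node of data & data.

Fixpoint dsize (x : data) : nat :=
  if x is Node a b then (dsize a + dsize b).+1 else 1.

Inductive expr := EVar | ELeaf | ENode of expr & expr | EFst of expr | ESnd of expr.

Fixpoint eval (e : expr) (x : data) : data :=
  match e with
  | EVar => x
  | ELeaf => Leaf
  | ENode e1 e2 => Node (eval e1 x) (eval e2 x)
  | EFst e1 => if eval e1 x is Node a _ then a else Leaf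
  | ESnd e1 => if eval e1 x is Node _ b then b else Leaf
  end.

Inductive cmd :=
  | Assign of expr
  | Seq of cmd & cmd
  | If of expr & cmd & cmd
  | While of expr & cmd.

(** [run c x y t]: started with value [x] in the variable, [c] halts with value
    [y] after time [t].  [Leaf] is the only false value. *)
Inductive run : cmd -> data -> data -> nat -> Prop :=
  | run_assign e x :
      run (Assign e) x (eval e x) (dsize (eval e x))
  | run_seq c1 c2 x y z t1 t2 :
      run c1 x y t1 -> run c2 y z t2 -> run (Seq c1 c2) x z (t1 + t2)
  | run_if_true e c1 c2 x y t :
      eval e x <> Leaf -> run c1 x y t -> run (If e c1 c2) x y t.+1
  | run_if_false e c1 c2 x y t :
      eval e x = Leaf -> run c2 x y t -> run (If e c1 c2) x y t.+1
  | run_while_false e c x :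
      eval e x = Leaf -> run (While e c) x x 1
  | run_while_true e c x y z t1 t2 :
      eval e x <> Leaf -> run c x y t1 -> run (While e c) y z t2 ->
      run (While e c) x z (t1 + t2).+1.

Fixpoint enc_nat (n : nat) : data :=
  if n is m.+1 then Node Leaf (enc_nat m) else Leaf.

Definition enc_seq (T : Type) (enc : T -> data) (s : seq T) : data :=
  foldr (fun x d => Node (enc x) d) Leaf s.

Definition computable (f : nat -> nat) : Prop :=
  exists p : cmd, forall n, exists t, run p (enc_nat n) (enc_nat (f n)) t.

(** * Parameterized problems, fpt-reductions, W[1] *)

(** The question is [yes x k], where [x] is presented as [enc x] and [k] is the
    parameter.  Languages are the case [inst := data] and [enc := id]; a general
    [inst] restricts attention to well-formed inputs, and reductions have to
    output well-formed inputs. *)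
Record pproblem := PProblem {
  inst : Type;
  enc : inst -> data;
  yes : inst -> nat -> Prop
}.

Definition restrict (A : pproblem) (S : inst A -> Prop) : pproblem :=
  {| inst := {x : inst A | S x};
     enc := fun x => enc (sval x);
     yes := fun x k => yes (sval x) k |}.

Definition fpt_reducible (A B : pproblem) : Prop :=
  exists (p : cmd) (f g : nat -> nat) (c : nat),
    [/\ computable f, computable g &
        forall (x : inst A) (k : nat), exists (y : inst B) (l t : nat),
          [/\ run p (Node (enc x) (enc_nat k)) (Node (enc y) (enc_nat l)) t,
              t <= f k * dsize (enc x) ^ c,
              l <= g k &
              yes x k <-> yes y l]].

(** A Boolean circuit with [n] inputs is listed in topological order: wires
    [0, ..., n - 1] are the inputs, wire [n + i] is the output of gate [i], and
    the last wire is the output of the circuit. *)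
Inductive gate := Not of nat | And of seq nat | Or of seq nat.

Definition fanin (g : gate) : seq nat :=
  match g with Not w => [:: w] | And ws => ws | Or ws => ws end.

Definition gate_ok (g : gate) : bool :=
  match g with
  | Not _ => true
  | And ws => uniq ws && (2 <= size ws)
  | Or ws => uniq ws && (2 <= size ws)
  end.

Definition circuit_ok (n : nat) (gs : seq gate) : bool :=
  [&& 0 < n + size gs,
      all gate_ok gs &
      [forall i : 'I_(size gs),
         all (fun w => w < n + i) (fanin (nth (Not 0) gs i))]].

Record circuit := Circuit {
  inputs : nat;
  gates : seq gate;
  circuitP : circuit_ok inputs gates
}.

Definition wire_values (T : Type) (step : gate -> seq T -> T) (init : seq T)
    (gs : seq gate) : seq T :=
  foldl (fun vs g => rcons vs (step g vs)) init gs.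

Definition gate_value (g : gate) (vs : seq bool) : bool :=
  match g with
  | Not w => ~~ nth false vs w
  | And ws => all (nth false vs) ws
  | Or ws => has (nth false vs) ws
  end.

Definition circuit_value (C : circuit) (a : (inputs C).-tuple bool) : bool :=
  last false (wire_values gate_value a (gates C)).

(** Maximum of [\sum weight g] over the gates [g] of a path from an input to the
    output. *)
Definition longest_path (weight : gate -> nat) (C : circuit) : nat :=
  last 0 (wire_values
            (fun g vs => weight g + \max_(w <- fanin g) nth 0 vs w)
            (nseq (inputs C) 0) (gates C)).

Definition depth : circuit -> nat := longest_path (fun=> 1).

Definition weft : circuit -> nat :=
  longest_path (fun g => 2 < size (fanin g)).

Definition enc_gate (g : gate) : data :=
  match g with
  | Not w => Node (enc_nat 0) (enc_nat w)
  | And ws => Node (enc_nat 1) (enc_seq enc_nat ws)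
  | Or ws => Node (enc_nat 2) (enc_seq enc_nat ws)
  end.

Definition enc_circuit (C : circuit) : data :=
  Node (enc_nat (inputs C)) (enc_seq enc_gate (gates C)).

Definition weighted_circuit_sat : pproblem :=
  {| inst := circuit;
     enc := enc_circuit;
     yes := fun C k => exists a : (inputs C).-tuple bool,
              count id a = k /\ circuit_value a |}.

(** The class W[t]. *)
Definition in_W (t : nat) (A : pproblem) : Prop :=
  exists d : nat,
    fpt_reducible A
      (@restrict weighted_circuit_sat (fun C => weft C <= t /\ depth C <= d)).

Definition W_hard (t : nat) (B : pproblem) : Prop :=
  forall A : pproblem, in_W t A -> fpt_reducible A B.

(** * Temporal graphs *)

(** Time [t] of [{1, ..., lifetime}] is the ordinal of value [t - 1]; the value
    of [label] outside the arcs is irrelevant. *)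
Record tdigraph := TDigraph {
  nverts : nat;
  lifetime : nat;
  edge : rel 'I_nverts;
  label : 'I_nverts -> 'I_nverts -> {set 'I_lifetime}
}.

(** The path visits [u :: p] and traverses its successive arcs, which are
    [zip (u :: p) p], at times [ts]. *)
Definition temporal_path (G : tdigraph) (u v : 'I_(nverts G))
    (p : seq 'I_(nverts G)) (ts : seq 'I_(lifetime G)) : bool :=
  [&& uniq (u :: p), path (@edge G) u p, last u p == v,
      size ts == size p,
      all (fun et => et.2 \in label et.1.1 et.1.2) (zip (zip (u :: p) p) ts) &
      sorted leq (map val ts)].

Definition temporally_reaches_in (G : tdigraph) (X : {set 'I_(nverts G)})
    (u v : 'I_(nverts G)) : Prop :=
  exists p ts, temporal_path u v p ts /\ {subset u :: p <= X}.

Definition closed_tc_set (G : tdigraph) (X : {set 'I_(nverts G)}) : Prop :=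
  forall u v, u \in X -> v \in X ->
    temporally_reaches_in X u v /\ temporally_reaches_in X v u.

Definition closed_tuc_set (G : tdigraph) (X : {set 'I_(nverts G)}) : Prop :=
  forall u v, u \in X -> v \in X ->
    temporally_reaches_in X u v \/ temporally_reaches_in X v u.

Definition inclusion_maximal (V : finType) (P : {set V} -> Prop) (X : {set V})
    : Prop :=
  P X /\ forall Y : {set V}, P Y -> X \subset Y -> Y = X.

Definition closed_TCC (G : tdigraph) : {set 'I_(nverts G)} -> Prop :=
  inclusion_maximal (@closed_tc_set G).

Definition closed_TUCC (G : tdigraph) : {set 'I_(nverts G)} -> Prop :=
  inclusion_maximal (@closed_tuc_set G).

(** The order, the lifetime, and the list of all [((u, v), times)] for the arcs
    [uv] in lexicographic order, all numbers being in unary. *)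
Definition enc_tdigraph (G : tdigraph) : data :=
  Node (enc_nat (nverts G))
   (Node (enc_nat (lifetime G))
      (enc_seq
         (fun uv : 'I_(nverts G) * 'I_(nverts G) =>
            Node (Node (enc_nat uv.1) (enc_nat uv.2))
                 (enc_seq (fun t : 'I_(lifetime G) => enc_nat t.+1)
                    [seq t <- enum 'I_(lifetime G) | t \in label uv.1 uv.2]))
         [seq uv <- [seq (u, v) | u <- enum 'I_(nverts G),
                                  v <- enum 'I_(nverts G)]
            | edge uv.1 uv.2])).

Definition closed_TCC_problem : pproblem :=
  {| inst := tdigraph;
     enc := enc_tdigraph;
     yes := fun G k => exists X, closed_TCC (G := G) X /\ k <= #|X| |}.

Definition closed_TUCC_problem : pproblem :=
  {| inst := tdigraph;
     enc := enc_tdigraph;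
     yes := fun G k => exists X, closed_TUCC (G := G) X /\ k <= #|X| |}.

(* Main.v *)
Require Import Defs.
From Stdlib Require Import Classical.
From mathcomp Require Import all_boot all_algebra zify ring.
Set Implicit Arguments.
Unset Strict Implicit.
Unset Printing Implicit Defensive.
Import GRing.Theory.

(** From cliques to components.  Given a graph H, take two vertices [a_v], [b_v]
    for every vertex [v], arcs [b_v -> a_v] at times 1 and 3, and arcs
    [a_v -> b_w] at time 2 whenever [v = w] or [vw] is an edge of H.  A temporal
    path uses at most one arc [a_v -> b_w], so it stays over [v] or joins two
    neighbours; conversely, over a clique everything is reachable within the
    clique.  Hence a (unilateral) component of size at least [2 m] exists iff H
    has a clique of size [m].

    From circuits to cliques.  A circuit of weft 1 and depth [d] is true iff one
    of polynomially many certificates holds, a certificate being a list of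
    requirements "wire [w] has value [s]" on wires of weft 0.  The number of
    requirements violated by a set S of true inputs is a multilinear polynomial
    in S of degree at most [2 ^ d], so it is the sum, over the subsets T of S of
    at most that size, of the finite difference along T at the empty set, and
    this difference is computed by evaluating the circuit.  A clique spells out
    a certificate, the [k] elements of S, and the partial sums of these
    differences, one vertex per index set T; the sums close up cyclically, so
    their total is 0.

    The reduction is polynomial because it is composed of list operations, under
    which polynomial time on encoded data is closed. *)

(** * Polynomial time *)

Lemma dsize_gt0 x : 0 < dsize x.
Proof. by case: x. Qed.

Lemma run_size c x y t : run c x y t -> dsize y <= dsize x + t.
Proof. by elim=> *; lia. Qed.

Fixpoint sub_fst (e : expr) : expr :=
  match e with
  | EVar => EFst EVar
  | ELeaf => ELeaf
  | ENode e1 e2 => ENode (sub_fst e1) (sub_fst e2)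
  | EFst e1 => EFst (sub_fst e1)
  | ESnd e1 => ESnd (sub_fst e1)
  end.

(** A program owns a single variable, so data that must survive a computation is parked in the
    second component while the command works on the first. *)
Fixpoint on_fst (c : cmd) : cmd :=
  match c with
  | Assign e => Assign (ENode (sub_fst e) (ESnd EVar))
  | Seq c1 c2 => Seq (on_fst c1) (on_fst c2)
  | If e c1 c2 => If (sub_fst e) (on_fst c1) (on_fst c2)
  | While e c1 => While (sub_fst e) (on_fst c1)
  end.

Lemma eval_sub_fst e x r : eval (sub_fst e) (Node x r) = eval e x.
Proof. by elim: e => //= [e1 -> e2 ->|e ->|e ->]. Qed.

(** Only assignments become dearer: each copies [r] once more, and since a stored value has size at
    least 1 this multiplies its cost by at most [(dsize r).+2]. *)
Lemma run_on_fst c x y t r : run c x y t ->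
  exists2 t', run (on_fst c) (Node x r) (Node y r) t' & t' <= t * (dsize r).+2.
Proof.
elim=> {c x y t} /=.
- move=> e x; exists (dsize (Node (eval e x) r)).
    by rewrite -{1 2}(eval_sub_fst e x r); exact: (run_assign (ENode _ (ESnd EVar))).
  by rewrite /=; have := dsize_gt0 (eval e x); nia.
- move=> c1 c2 x y z t1 t2 _ [u1 r1 l1] _ [u2 r2 l2]; exists (u1 + u2); last by nia.
  exact: run_seq r1 r2.
- move=> e c1 c2 x y t ne _ [u ru lu]; exists u.+1; last by nia.
  by apply: run_if_true => //; rewrite eval_sub_fst.
- move=> e c1 c2 x y t ne _ [u ru lu]; exists u.+1; last by nia.
  by apply: run_if_false => //; rewrite eval_sub_fst.
- move=> e c x ne; exists 1; last by nia.
  by apply: run_while_false; rewrite eval_sub_fst.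
- move=> e c x y z t1 t2 ne _ [u1 r1 l1] _ [u2 r2 l2]; exists (u1 + u2).+1; last by nia.
  by apply: run_while_true r1 r2; rewrite eval_sub_fst.
Qed.

(** * Encoded types and polynomial bounds *)

Structure enctype := EncType { carrier :> Type; code : carrier -> data }.
Arguments code {e} x : simpl never.

Canonical nat_enctype := EncType enc_nat.
Canonical bool_enctype := EncType (fun b : bool => enc_nat b).
Canonical unit_enctype := EncType (fun _ : unit => Leaf).
Canonical prod_enctype (A B : enctype) :=
  EncType (fun x : A * B => Node (code x.1) (code x.2)).
Canonical seq_enctype (A : enctype) := EncType (enc_seq (@code A)).
Canonical gate_enctype := EncType enc_gate.
Canonical circuit_enctype := EncType enc_circuit.

Definition csize (A : enctype) (a : A) : nat := dsize (code a).
Arguments csize {A} a : simpl never.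

Lemma csize_gt0 (A : enctype) (a : A) : 0 < csize a.
Proof. exact: dsize_gt0. Qed.

Lemma csize_pair (A B : enctype) (a : A) (b : B) :
  csize (a, b) = (csize a + csize b).+1.
Proof. by []. Qed.

Lemma csize_cons (A : enctype) (a : A) s : csize (a :: s) = (csize a + csize s).+1.
Proof. by []. Qed.

Lemma csize_nat (n : nat) : csize n = n.*2.+1.
Proof. by rewrite /csize /code; elim: n => //= n ->; lia. Qed.

Lemma csize_bool (b : bool) : csize b <= 3.
Proof. by case: b. Qed.

Lemma csize_cat (A : enctype) (s1 s2 : seq A) :
  (csize (s1 ++ s2)).+1 = csize s1 + csize s2.
Proof. elim: s1 => //= a s1. rewrite !csize_cons; lia. Qed.

Lemma size_csize (A : enctype) (s : seq A) : size s < csize s.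
Proof. by elim: s => //= a s; rewrite csize_cons; have := csize_gt0 a; lia. Qed.

Lemma csize_rev (A : enctype) (s : seq A) : csize (rev s) = csize s.
Proof.
elim: s => // a s IH; rewrite rev_cons -cats1 csize_cons.
by have := csize_cat (rev s) [:: a]; rewrite csize_cons IH [csize [::]]/csize /=; lia.
Qed.

Lemma csize_seq_leq (A : enctype) (s : seq A) m :
  all (fun a => csize a <= m) s -> csize s <= (size s * m.+1).+1.
Proof. by elim: s => //= a s IH /andP [la /IH]; rewrite csize_cons mulSn; lia. Qed.

(** The base is at least 2 because sizes are positive, so constants and sums are absorbed by the
    exponent and one power can represent any polynomial bound. *)
Definition poly_bounded (A : enctype) (h : A -> nat) : Prop :=
  exists c, forall a, h a <= (csize a).+1 ^ c.
Arguments poly_bounded {A} h.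

Section PolyBounded.
Variable A : enctype.
Implicit Types h : A -> nat.

Lemma poly_leq h1 h2 : (forall a, h1 a <= h2 a) -> poly_bounded h2 -> poly_bounded h1.
Proof. by move=> le [c hc]; exists c => a; apply: leq_trans (le a) (hc a). Qed.

Lemma poly_const n : poly_bounded (fun _ : A => n).
Proof.
exists n => a; apply: leq_trans (ltnW (ltn_expl n (ltnSn 1))) _.
by case: n => // n; rewrite leq_exp2r // ltnS csize_gt0.
Qed.

Lemma poly_csize : poly_bounded (@csize A).
Proof. by exists 1 => a; rewrite expn1. Qed.

Lemma poly_mul h1 h2 :
  poly_bounded h1 -> poly_bounded h2 -> poly_bounded (fun a => h1 a * h2 a).
Proof.
move=> [c1 l1] [c2 l2]; exists (c1 + c2) => a.
by rewrite expnD leq_mul.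
Qed.

Lemma poly_add h1 h2 :
  poly_bounded h1 -> poly_bounded h2 -> poly_bounded (fun a => h1 a + h2 a).
Proof.
move=> [c1 l1] [c2 l2]; exists (c1 + c2).+1 => a.
have b2 : 1 < (csize a).+1 by rewrite ltnS csize_gt0.
rewrite expnS expnD; have := l1 a; have := l2 a.
have := expn_gt0 (csize a).+1 c1; have := expn_gt0 (csize a).+1 c2.
rewrite /= => p2 p1 q2 q1.
(* For positive [x] and [y], [x + y <= 2 * (x * y)]; the factor 2 is paid by the extra unit in the
   exponent. *)
apply: (@leq_trans (2 * ((csize a).+1 ^ c1 * (csize a).+1 ^ c2))); first by nia.
by rewrite leq_mul2r b2 orbT.
Qed.

Lemma poly_S h : poly_bounded h -> poly_bounded (fun a => (h a).+1).
Proof.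
move=> ph; apply: poly_leq (poly_add (poly_const 1) ph) => a.
by rewrite add1n.
Qed.

Lemma poly_exp h c : poly_bounded h -> poly_bounded (fun a => h a ^ c).
Proof.
move=> ph; elim: c => [|c IH]; first exact: poly_const.
by apply: poly_leq (poly_mul ph IH) => a; rewrite expnS.
Qed.
End PolyBounded.

Lemma poly_comp (A B : enctype) (f : A -> B) (h : B -> nat) :
  poly_bounded h -> poly_bounded (csize \o f) -> poly_bounded (h \o f).
Proof.
move=> [c hc] pf; apply: poly_leq (poly_exp c (poly_S pf)) => a; exact: hc.
Qed.

(** * Polynomial time and program constructs *)

Definition polytime (A B : enctype) (f : A -> B) : Prop :=
  exists (p : cmd) (h : A -> nat), poly_bounded h /\
    forall a, exists2 t, run p (code a) (code (f a)) t & t <= h a.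

(** Every assignment pays for the full size of what it stores, so an output is at most as large as
    the input plus the running time. *)
Lemma polytime_csize (A B : enctype) (f : A -> B) :
  polytime f -> poly_bounded (csize \o f).
Proof.
move=> [p [h [ph hp]]]; apply: poly_leq (poly_add (poly_csize A) ph) => a.
have [t /run_size r l] := hp a; rewrite /= /csize; lia.
Qed.

Lemma polytime_ext (A B : enctype) (f g : A -> B) :
  f =1 g -> polytime f -> polytime g.
Proof.
move=> fg [p [h [ph hp]]]; exists p, h; split=> // a.
by rewrite -fg; exact: hp.
Qed.

Lemma polytime_expr (A B : enctype) (f : A -> B) e :
  (forall a, eval e (code a) = code (f a)) -> poly_bounded (csize \o f) ->
  polytime f.
Proof.
move=> ef pf; exists (Assign e), (csize \o f); split=> // a.
exists (csize (f a)) => //; rewrite /csize -ef; exact: run_assign.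
Qed.

Lemma polytime_id (A : enctype) : polytime (fun a : A => a).
Proof. by apply: (@polytime_expr _ _ _ EVar) => //; exact: poly_csize. Qed.

Fixpoint quote (x : data) : expr :=
  if x is Node a b then ENode (quote a) (quote b) else ELeaf.

Lemma polytime_const (A B : enctype) (b : B) : polytime (fun _ : A => b).
Proof.
apply: (@polytime_expr _ _ _ (quote (code b))); last exact: poly_const.
by move=> a; elim: (code b) => //= x -> y ->.
Qed.

Lemma polytime_comp (A B C : enctype) (f : A -> B) (g : B -> C) :
  polytime g -> polytime f -> polytime (fun a => g (f a)).
Proof.
move=> [q [k [pk hq]]] pf; have := pf; move=> [p [h [ph hp]]].
exists (Seq p q), (fun a => h a + k (f a)); split.
  by apply: poly_add ph _; apply: (poly_comp (h := k)) => //; exact: polytime_csize.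
move=> a; have [t r l] := hp a; have [u s m] := hq (f a).
by exists (t + u); [exact: run_seq r s | exact: leq_add].
Qed.

Lemma polytime_pair (A B C : enctype) (f : A -> B) (g : A -> C) :
  polytime f -> polytime g -> polytime (fun a => (f a, g a)).
Proof.
move=> pf pg; have sf := polytime_csize pf; have sg := polytime_csize pg.
have [p [h [ph hp]]] := pf; have [q [k [pk hq]]] := pg.
(* The variable runs through [(a, a)], [(f a, a)], [(a, f a)], [(g a, f a)], [(f a, g a)]. *)
exists (Seq (Assign (ENode EVar EVar)) (Seq (on_fst p)
  (Seq (Assign (ENode (ESnd EVar) (EFst EVar)) ) (Seq (on_fst q)
    (Assign (ENode (ESnd EVar) (EFst EVar))))))).
exists (fun a => (csize a + csize a).+1 + (h a * (csize a).+2 +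
  ((csize a + csize (f a)).+1 + (k a * (csize (f a)).+2 +
    (csize (f a) + csize (g a)).+1)))); split.
  by do ?[apply: poly_add | apply: poly_S | apply: poly_mul |
          exact: poly_csize | exact: ph | exact: pk | exact: sf | exact: sg].
move=> a; have [t r l] := hp a; have [u s m] := hq a.
have [t' r' l'] := run_on_fst (code a) r.
have [u' s' m'] := run_on_fst (code (f a)) s.
eexists.
  apply: run_seq (run_assign _ _) _; apply: run_seq r' _.
  apply: run_seq (run_assign _ _) _; apply: run_seq s' _; exact: run_assign.
rewrite /= -!/(csize _); rewrite -/(csize a) -/(csize (f a)) in l' m'.
by nia.
Qed.

Lemma polytime_fst (A B C : enctype) (f : A -> B * C) :
  polytime f -> polytime (fun a => (f a).1).
Proof.
apply: polytime_comp; apply: (@polytime_expr _ _ _ (EFst EVar)) => //.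
by apply: poly_leq (poly_csize _) => -[b c]; rewrite /= csize_pair; lia.
Qed.

Lemma polytime_snd (A B C : enctype) (f : A -> B * C) :
  polytime f -> polytime (fun a => (f a).2).
Proof.
apply: polytime_comp; apply: (@polytime_expr _ _ _ (ESnd EVar)) => //.
by apply: poly_leq (poly_csize _) => -[b c]; rewrite /= csize_pair; lia.
Qed.

Lemma polytime_fun2 (A B C D : enctype) (f : A -> B) (g : A -> C) (op : B -> C -> D) :
  polytime (fun x : B * C => op x.1 x.2) -> polytime f -> polytime g ->
  polytime (fun a => op (f a) (g a)).
Proof.
move=> po pf pg; apply: polytime_comp po (polytime_pair pf pg).
Qed.

Lemma polytime_if (A B : enctype) (b : A -> bool) (f g : A -> B) :
  polytime b -> polytime f -> polytime g ->
  polytime (fun a => if b a then f a else g a).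
Proof.
move=> [pb [hb [qb rb]]] [p [h [ph hp]]] [q [k [pk hq]]].
exists (Seq (Assign (ENode EVar EVar)) (Seq (on_fst pb)
  (If (EFst EVar) (Seq (Assign (ESnd EVar)) p) (Seq (Assign (ESnd EVar)) q)))).
exists (fun a => (csize a + csize a).+1 + (hb a * (csize a).+2 +
   (csize a + (h a + k a)).+1)); split.
  by do ?[apply: poly_add | apply: poly_S | apply: poly_mul |
          exact: poly_csize | exact: ph | exact: pk | exact: qb].
move=> a; have [t r l] := hp a; have [u s m] := hq a; have [v w n] := rb a.
have [v' w' n'] := run_on_fst (code a) w; rewrite -/(csize a) in n'.
case: (b a) w' => w'.
- eexists; first apply: run_seq (run_assign _ _) _; first apply: run_seq w' _.
    apply: run_if_true; first by rewrite /= /code.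
    exact: run_seq (run_assign (ESnd EVar) (Node (code true) (code a))) r.
  by rewrite /= -!/(csize _); nia.
- eexists; first apply: run_seq (run_assign _ _) _; first apply: run_seq w' _.
    apply: run_if_false; first by rewrite /= /code.
    exact: run_seq (run_assign (ESnd EVar) (Node (code false) (code a))) s.
  by rewrite /= -!/(csize _); nia.
Qed.

(** The loop state is [(l, (acc, e))]. A round rearranges it to [((e, (a, acc)), (l', e))], runs [c]
    on the first component and reassembles the state with the new accumulator. *)
Definition fold_cmd (c : cmd) : cmd :=
  While (EFst EVar)
    (Seq (Assign (ENode (ENode (ESnd (ESnd EVar))
                          (ENode (EFst (EFst EVar)) (EFst (ESnd EVar))))
                        (ENode (ESnd (EFst EVar)) (ESnd (ESnd EVar)))))
    (Seq (on_fst c)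
      (Assign (ENode (EFst (ESnd EVar)) (ENode (EFst EVar) (ESnd (ESnd EVar))))))).

Lemma run_fold_cmd (E T U : enctype) (step : E -> U -> T -> U) c h e m n :
  (forall a acc, exists2 t,
     run c (code (e, (a, acc))) (code (step e acc a)) t &
     t <= h (csize (e, (a, acc)))) ->
  {homo h : x y / x <= y} ->
  forall l acc,
  (forall i, csize (foldl (step e) acc (take i l)) <= m) -> csize l <= n ->
  exists2 t,
    run (fold_cmd c) (Node (code l) (Node (code acc) (code e)))
      (Node Leaf (Node (code (foldl (step e) acc l)) (code e))) t &
    t <= (size l * (csize e * 3 + m * 2 + n * 2 + 10 +
                    h (csize e + m + n).+2 * (csize e + n).+3)).+1.
Proof.
move=> hc hmono; elim=> [|a l IH] acc hm hn.
  by exists 1 => //; apply: run_while_false.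
have hm' i : csize (foldl (step e) (step e acc a) (take i l)) <= m.
  exact: (hm i.+1).
have hn' : csize l <= n by rewrite csize_cons in hn; lia.
have [t r b] := IH _ hm' hn'.
have [s q d] := hc a acc.
have [s' q' d'] := run_on_fst (Node (code l) (code e)) q.
have sa : csize acc <= m by have := hm 0; rewrite take0.
have sa' : csize (step e acc a) <= m by have := hm' 0; rewrite take0.
have sal : csize a + csize l < n by rewrite csize_cons in hn; lia.
eexists.
  apply: run_while_true; first by rewrite /= /code.
    apply: run_seq (run_assign _ _) _; apply: run_seq q' _; exact: run_assign.
  exact: r.
rewrite /= -!/(csize _).
have hs : s <= h (csize e + m + n).+2.
  by apply: leq_trans d _; apply: hmono; rewrite !csize_pair; lia.
rewrite /= -!/(csize _) in d'.
set H := h _ in b hs *.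
have : s * (csize l + csize e).+3 <= H * (csize e + n).+3.
  by apply: leq_mul => //; lia.
rewrite mulSn; set X := _ * (csize e + n).+3 in b *.
by set Y := size l * _ in b *; lia.
Qed.

(** Iterating a polynomial-time step may blow up exponentially, hence the hypothesis that the
    accumulator after every prefix has polynomial size. Each round then costs polynomial time, and
    there are fewer rounds than [csize (l e)]. *)
Lemma polytime_foldl (E T U : enctype) (step : E -> U -> T -> U)
    (init : E -> U) (l : E -> seq T) (bound : E -> nat) :
  polytime (fun x : E * (T * U) => step x.1 x.2.2 x.2.1) ->
  polytime init -> polytime l -> poly_bounded bound ->
  (forall e i, csize (foldl (step e) (init e) (take i (l e))) <= bound e) ->
  polytime (fun e => foldl (step e) (init e) (l e)).
Proof.
move=> [c [h0 [[d hd] hc]]] pinit pl pb hb.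
have [p [k [pk hp]]] := polytime_pair pl (polytime_pair pinit (polytime_id E)).
pose h x := x.+1 ^ d.
exists (Seq p (Seq (fold_cmd c) (Assign (EFst (ESnd EVar))))).
exists (fun e => k e + ((csize (l e) * (csize e * 3 + bound e * 2 + csize (l e) * 2 + 10 +
   h (csize e + bound e + csize (l e)).+2 * (csize e + csize (l e)).+3)).+1 +
   bound e)); split.
  rewrite /h; have sl := polytime_csize pl.
  by do ?[apply: poly_add | apply: poly_S | apply: poly_mul | apply: poly_exp |
          exact: poly_csize | exact: pk | exact: pb | exact: sl | exact: poly_const].
move=> e; have [t r le] := hp e.
have hc' a acc : exists2 t,
     run c (code (e, (a, acc))) (code (step e acc a)) t &
     t <= h (csize (e, (a, acc))).
  by have [u ru lu] := hc (e, (a, acc)); exists u => //; apply: leq_trans lu (hd _).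
have hmono : {homo h : x y / x <= y}.
  by move=> x y xy; rewrite /h; case: (d) => // d'; rewrite leq_exp2r.
have [u ru lu] := run_fold_cmd hc' hmono (hb e) (leqnn _).
eexists.
  by apply: run_seq r _; apply: run_seq ru _; exact: run_assign.
rewrite /= -!/(csize _); apply: leq_add => //; apply: leq_add; last first.
  by have := hb e (size (l e)); rewrite take_size.
apply: leq_trans lu _; rewrite ltnS leq_mul2r; apply/orP; right.
by rewrite ltnW // size_csize.
Qed.

(** * Operations on lists, numbers and circuits *)

Lemma polytime_isleaf (A : enctype) (f : A -> bool) :
  (forall a, code a = Leaf <-> f a) -> polytime f.
Proof.
move=> hf; exists (If EVar (Assign ELeaf) (Assign (ENode ELeaf ELeaf))), (fun=> 4).
split=> [|a]; first exact: poly_const.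
case ca: (code a) => [|x y].
- have -> : f a by apply/hf.
  by exists 4 => //; apply: run_if_false => //; exact: (run_assign (ENode ELeaf ELeaf)).
- have /negbTE -> : ~~ f a by apply/negP => /hf; rewrite ca.
  by exists 2 => //; apply: run_if_true => //; exact: (run_assign ELeaf).
Qed.

Lemma polytime_nilp (E A : enctype) (l : E -> seq A) :
  polytime l -> polytime (fun e => nilp (l e)).
Proof.
by apply: (polytime_comp (g := @nilp A)); apply: polytime_isleaf => -[].
Qed.

Lemma polytime_eq0 (E : enctype) (n : E -> nat) : polytime n -> polytime (fun e => n e == 0).
Proof.
move=> pn; apply: (@polytime_comp _ nat_enctype _ n (eq_op^~ 0)) _ pn.
by apply: polytime_isleaf => -[].
Qed.

Lemma polytime_negb (E : enctype) (b : E -> bool) : polytime b -> polytime (fun e => ~~ b e).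
Proof.
move=> pb; apply: (@polytime_ext _ _ (fun e => if b e then false else true)).
  by move=> e; case: (b e).
by apply: polytime_if => //; exact: polytime_const.
Qed.

Lemma polytime_cons (E A : enctype) (a : E -> A) (l : E -> seq A) :
  polytime a -> polytime l -> polytime (fun e => a e :: l e).
Proof.
move=> pa pl; apply: (polytime_fun2 (op := cons)) pa pl.
by apply: (polytime_expr (e := EVar)) => //; exact: poly_csize.
Qed.

Lemma polytime_behead (E A : enctype) (l : E -> seq A) :
  polytime l -> polytime (fun e => behead (l e)).
Proof.
apply: (polytime_comp (g := behead)).
apply: (polytime_expr (e := ESnd EVar)); first by case.
by apply: poly_leq (poly_csize _) => -[] //= a s; rewrite csize_cons; lia.
Qed.

Lemma polytime_head (E A : enctype) (x0 : A) (l : E -> seq A) :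
  polytime l -> polytime (fun e => head x0 (l e)).
Proof.
(* On an empty list [EFst] would return [Leaf] instead of the code of [x0], so the default is first
   put into the list. *)
move=> pl; pose s e := if nilp (l e) then [:: x0] else l e.
have ps : polytime s.
  by apply: polytime_if => //; [exact: polytime_nilp | exact: polytime_const].
have es e : eval (EFst EVar) (code (s e)) = code (head x0 (l e)).
  by rewrite /s; case: (l e).
have [c hc] := polytime_csize pl.
case: ps => p [h [ph hp]].
exists (Seq p (Assign (EFst EVar))), (fun e => h e + ((csize e).+1 ^ c + csize x0)); split.
  apply: poly_add ph _; apply: poly_add; last exact: poly_const.
  by apply: poly_exp; apply: poly_S; exact: poly_csize.
move=> e; have [t r b] := hp e; exists (t + csize (head x0 (l e))).
  by apply: run_seq r _; rewrite /csize -es; exact: run_assign.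
have := hc e; rewrite /= => le; apply: leq_add b (leq_trans _ (leq_add le (leqnn _))).
by case: (l e) => [|y z] /=; [|rewrite csize_cons]; lia.
Qed.

Lemma csize_take (A : enctype) (i : nat) (s : seq A) : csize (take i s) <= csize s.
Proof.
by have := csize_cat (take i s) (drop i s); rewrite cat_take_drop;
   have := csize_gt0 (drop i s); lia.
Qed.

Lemma csize_drop (A : enctype) (i : nat) (s : seq A) : csize (drop i s) <= csize s.
Proof.
by have := csize_cat (take i s) (drop i s); rewrite cat_take_drop;
   have := csize_gt0 (take i s); lia.
Qed.

Lemma foldl_cons (A : enctype) (l s : seq A) : foldl (fun acc a => a :: acc) s l = catrev l s.
Proof. by elim: l s => //= a r IH t; rewrite IH. Qed.

Lemma polytime_catrev (E A : enctype) (l s : E -> seq A) :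
  polytime l -> polytime s -> polytime (fun e => catrev (l e) (s e)).
Proof.
move=> pl ps; apply: (@polytime_ext _ _ (fun e => foldl (fun acc a => a :: acc) (s e) (l e))).
  by move=> e; rewrite foldl_cons.
apply: (polytime_foldl (step := fun _ acc a => a :: acc)
          (bound := fun e => csize (l e) + csize (s e))) => //.
- by apply: polytime_cons; do ?[exact: polytime_id | apply: polytime_fst | apply: polytime_snd].
- by apply: poly_add; exact: polytime_csize.
- move=> e i; rewrite foldl_cons catrevE.
  have := csize_cat (rev (take i (l e))) (s e); rewrite csize_rev.
  by have := csize_take i (l e); lia.
Qed.

Lemma polytime_rev (E A : enctype) (l : E -> seq A) : polytime l -> polytime (fun e => rev (l e)).
Proof. by move=> pl; apply: polytime_catrev pl (polytime_const _ _). Qed.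

Lemma polytime_cat (E A : enctype) (l s : E -> seq A) :
  polytime l -> polytime s -> polytime (fun e => l e ++ s e).
Proof.
move=> pl ps; apply: polytime_ext (polytime_catrev (polytime_rev pl) ps) => e.
by rewrite catrevE revK.
Qed.

Lemma polytime_rcons (E A : enctype) (l : E -> seq A) (a : E -> A) :
  polytime l -> polytime a -> polytime (fun e => rcons (l e) (a e)).
Proof.
move=> pl pa; have ps := polytime_cat pl (polytime_cons pa (polytime_const _ [::])).
apply: polytime_ext ps => e.
by rewrite cats1.
Qed.

Lemma all_csize (A : enctype) (s : seq A) : all (fun a => csize a <= csize s) s.
Proof.
elim: s => //= a s IH; rewrite csize_cons.
apply/andP; split; first by lia.
by apply: sub_all IH => b; lia.
Qed.

Lemma foldl_map_rev (A B : enctype) (f : A -> B) s l :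
  foldl (fun acc a => f a :: acc) s l = catrev (map f l) s.
Proof. by elim: l s => //= a l IH s; rewrite IH. Qed.

Lemma polytime_map (E A B : enctype) (f : E -> A -> B) (l : E -> seq A) :
  polytime (fun x : E * A => f x.1 x.2) -> polytime l ->
  polytime (fun e => map (f e) (l e)).
Proof.
move=> pf pl; have [c hc] := polytime_csize pf.
apply: (@polytime_ext _ _ (fun e => rev (foldl (fun acc a => f e a :: acc) [::] (l e)))).
  by move=> e; rewrite foldl_map_rev catrevE cats0 revK.
apply: polytime_rev.
pose m e := (csize e + csize (l e)).+2 ^ c.
apply: (polytime_foldl (step := fun e acc a => f e a :: acc)
          (bound := fun e => (csize (l e) * (m e).+1).+1)) => //.
- apply: polytime_cons; last by do ?[exact: polytime_id | apply: polytime_snd].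
  apply: (polytime_fun2 (op := f)) pf _ _;
    by do ?[exact: polytime_id | apply: polytime_fst | apply: polytime_snd].
- exact: polytime_const.
- rewrite /m; have sl := polytime_csize pl.
  by do ?[apply: poly_add | apply: poly_S | apply: poly_mul | apply: poly_exp |
          exact: poly_csize | exact: sl].
- move=> e i; rewrite foldl_map_rev catrevE cats0 csize_rev map_take.
  apply: leq_trans (csize_take _ _) _.
  apply: (@leq_trans (size (map (f e) (l e)) * (m e).+1).+1).
    apply: csize_seq_leq; rewrite all_map; apply: sub_all (all_csize _) => a /= la.
    apply: leq_trans (hc (e, a)) _; rewrite /m csize_pair.
    by case: (c) => // c'; rewrite leq_exp2r //; lia.
  by rewrite size_map ltnS leq_mul2r ltnW ?orbT // size_csize.
Qed.

Lemma foldl_flatten (A : enctype) (s : seq A) l :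
  foldl (fun acc r => acc ++ r) s l = s ++ flatten l.
Proof. by elim: l s => [|r l IH] s /=; rewrite ?cats0 // IH catA. Qed.

Lemma csize_flatten (A : enctype) (l : seq (seq A)) : csize (flatten l) <= csize l.
Proof.
elim: l => //= s l IH; rewrite csize_cons.
by have := csize_cat s (flatten l); lia.
Qed.

Lemma polytime_flatten (E A : enctype) (l : E -> seq (seq A)) :
  polytime l -> polytime (fun e => flatten (l e)).
Proof.
move=> pl; apply: (@polytime_ext _ _ (fun e => foldl (fun acc s => acc ++ s) [::] (l e))).
  by move=> e; rewrite foldl_flatten.
apply: (polytime_foldl (step := fun _ acc s => acc ++ s) (bound := csize \o l)) => //.
- by apply: polytime_cat; do ?[exact: polytime_id | apply: polytime_fst | apply: polytime_snd].
- exact: polytime_const.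
- exact: polytime_csize.
- move=> e i; rewrite foldl_flatten /=.
  exact: leq_trans (csize_flatten _) (csize_take _ _).
Qed.

Lemma polytime_filter (E A : enctype) (p : E -> A -> bool) (l : E -> seq A) :
  polytime (fun x : E * A => p x.1 x.2) -> polytime l ->
  polytime (fun e => filter (p e) (l e)).
Proof.
move=> pp pl.
apply: (@polytime_ext _ _ (fun e =>
  flatten (map (fun a => if p e a then [:: a] else [::]) (l e)))).
  by move=> e; elim: (l e) => //= a s ->; case: ifP.
apply: polytime_flatten; apply: polytime_map pl; apply: polytime_if pp _ _.
- apply: polytime_cons; last exact: polytime_const.
  by apply: polytime_snd; exact: polytime_id.
- exact: polytime_const.
Qed.

Lemma polytime_has (E A : enctype) (p : E -> A -> bool) (l : E -> seq A) :
  polytime (fun x : E * A => p x.1 x.2) -> polytime l ->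
  polytime (fun e => has (p e) (l e)).
Proof.
move=> pp pl; apply: polytime_ext (polytime_negb (polytime_nilp (polytime_filter pp pl))) => e.
by rewrite has_count -size_filter lt0n.
Qed.

Lemma polytime_all (E A : enctype) (p : E -> A -> bool) (l : E -> seq A) :
  polytime (fun x : E * A => p x.1 x.2) -> polytime l ->
  polytime (fun e => all (p e) (l e)).
Proof.
move=> pp pl.
have ph := polytime_has (p := fun e a => ~~ p e a) (polytime_negb pp) pl.
apply: polytime_ext (polytime_negb ph) => e.
by rewrite -all_predC; apply: eq_all => a /=; rewrite negbK.
Qed.

Lemma polytime_succ (E : enctype) (n : E -> nat) : polytime n -> polytime (fun e => (n e).+1).
Proof.
move=> pn; apply: (@polytime_comp _ nat_enctype _ n S) _ pn.
apply: (polytime_expr (e := ENode ELeaf EVar)) => //.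
by apply: poly_leq (poly_S (poly_S (poly_csize _))) => m; rewrite /= !csize_nat; lia.
Qed.

Lemma polytime_pred (E : enctype) (n : E -> nat) : polytime n -> polytime (fun e => (n e).-1).
Proof.
move=> pn; apply: (@polytime_comp _ nat_enctype _ n predn) _ pn.
apply: (polytime_expr (e := ESnd EVar)); first by case.
by apply: poly_leq (poly_csize _) => m; rewrite /= !csize_nat; lia.
Qed.

Lemma polytime_size (E A : enctype) (l : E -> seq A) : polytime l -> polytime (fun e => size (l e)).
Proof.
have fs m (s : seq A) : foldl (fun n _ => n.+1) m s = m + size s.
  by elim: s m => [|a s IH] m /=; rewrite ?addn0 // IH; lia.
move=> pl; apply: (@polytime_ext _ _ (fun e => foldl (fun n _ => n.+1) 0 (l e))).
  by move=> e; rewrite fs.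
apply: (polytime_foldl (step := fun _ n _ => n.+1) (bound := fun e => csize (l e) * 2)) => //.
- by apply: polytime_succ; do ?[exact: polytime_id | apply: polytime_snd].
- exact: polytime_const.
- by apply: poly_mul (poly_const _ _); exact: polytime_csize.
- move=> e i; rewrite fs csize_nat.
  by have := size_csize (take i (l e)); have := csize_take i (l e); lia.
Qed.

(** A number in unary and a list of units have the same code. Numbers thereby serve as loop
    counters, and arithmetic reduces to list operations. *)
Lemma polytime_units (E : enctype) (n : E -> nat) :
  polytime n -> polytime (fun e => nseq (n e) tt).
Proof.
have cu m : code (nseq m tt) = code m by rewrite /code /=; elim: m => //= m ->.
apply: (polytime_comp (g := nseq^~ tt)); apply: (polytime_expr (e := EVar)) => [m|].
  by rewrite cu.
by apply: poly_leq (poly_csize _) => m; rewrite /csize /= cu.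
Qed.

Lemma polytime_drop (E A : enctype) (n : E -> nat) (l : E -> seq A) :
  polytime n -> polytime l -> polytime (fun e => drop (n e) (l e)).
Proof.
have fd (s : seq A) u : foldl (fun s _ => behead s) s u = drop (size u) s.
  elim: u s => [|x u IH] s /=; first by rewrite drop0.
  by rewrite IH -drop1 drop_drop addn1.
move=> pn pl.
apply: (@polytime_ext _ _ (fun e => foldl (fun s _ => behead s) (l e) (nseq (n e) tt))).
  by move=> e; rewrite fd size_nseq.
apply: (polytime_foldl (step := fun _ s _ => behead s) (bound := csize \o l)) => //.
- by apply: polytime_behead; do ?[exact: polytime_id | apply: polytime_snd].
- exact: polytime_units.
- exact: polytime_csize.
- by move=> e i; rewrite fd; exact: csize_drop.
Qed.

Lemma polytime_nth (E A : enctype) (x0 : A) (l : E -> seq A) (n : E -> nat) :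
  polytime l -> polytime n -> polytime (fun e => nth x0 (l e) (n e)).
Proof.
move=> pl pn; apply: polytime_ext (polytime_head x0 (polytime_drop pn pl)) => e.
by rewrite -nth0 nth_drop addn0.
Qed.

Lemma polytime_iota (E : enctype) (n : E -> nat) :
  polytime n -> polytime (fun e => iota 0 (n e)).
Proof.
(* The length of the accumulator is the next number to be listed. *)
have fi u : foldl (fun s (_ : unit) => size s :: s) [::] u = rev (iota 0 (size u)).
  elim/last_ind: u => [|u x IH] //; rewrite foldl_rcons IH size_rcons size_rev size_iota.
  by rewrite -addn1 iotaD add0n /= cats1 rev_rcons.
move=> pn; apply: (@polytime_ext _ _ (fun e =>
  rev (foldl (fun s _ => size s :: s) [::] (nseq (n e) tt)))).
  by move=> e; rewrite fi size_nseq revK.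
apply: polytime_rev.
apply: (polytime_foldl (step := fun _ s _ => size s :: s)
          (bound := fun e => (csize (n e) * (csize (n e)).+1).+1)) => //.
- apply: polytime_cons; first apply: polytime_size;
    by do ?[exact: polytime_id | apply: polytime_fst | apply: polytime_snd].
- exact: polytime_const.
- exact: polytime_units.
- by do ?[apply: poly_S | apply: poly_mul]; exact: polytime_csize.
- move=> e i; rewrite fi csize_rev.
  have ln : size (take i (nseq (n e) tt)) <= n e.
    by rewrite size_take_min size_nseq geq_minr.
  have le : n e <= csize (n e) by rewrite csize_nat; lia.
  apply: (@leq_trans (size (iota 0 (size (take i (nseq (n e) tt)))) * (csize (n e)).+1).+1).
    by apply: csize_seq_leq; apply/allP => m; rewrite mem_iota !csize_nat => /andP [_ lm];
       have := leq_trans lm ln; lia.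
  by rewrite size_iota ltnS leq_mul2r (leq_trans ln le) orbT.
Qed.

Lemma polytime_addn (E : enctype) (m n : E -> nat) :
  polytime m -> polytime n -> polytime (fun e => m e + n e).
Proof.
move=> /polytime_units pm /polytime_units pn.
apply: polytime_ext (polytime_size (polytime_cat pm pn)) => e.
by rewrite size_cat !size_nseq.
Qed.

Lemma polytime_subn (E : enctype) (m n : E -> nat) :
  polytime m -> polytime n -> polytime (fun e => m e - n e).
Proof.
move=> /polytime_units pm pn.
apply: polytime_ext (polytime_size (polytime_drop pn pm)) => e.
by rewrite size_drop size_nseq.
Qed.

Lemma polytime_muln (E : enctype) (m n : E -> nat) :
  polytime m -> polytime n -> polytime (fun e => m e * n e).
Proof.
move=> /polytime_units pm pn.
apply: (@polytime_ext _ _ (fun e => size (flatten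
  (map (fun _ => nseq (n e) tt) (nseq (m e) tt))))).
  by move=> e; rewrite map_nseq size_flatten /shape map_nseq sumn_nseq size_nseq mulnC.
apply/polytime_size/polytime_flatten/polytime_map => //; apply: polytime_units.
by apply: polytime_comp pn _; apply: polytime_fst; exact: polytime_id.
Qed.

Lemma polytime_expn (E : enctype) (m : E -> nat) c :
  polytime m -> polytime (fun e => m e ^ c).
Proof.
move=> pm; elim: c => [|c IH]; first exact: polytime_const.
by apply: polytime_ext (polytime_muln pm IH) => e; rewrite expnS.
Qed.

Lemma polytime_leq (E : enctype) (m n : E -> nat) :
  polytime m -> polytime n -> polytime (fun e => m e <= n e).
Proof. by move=> pm pn; exact/polytime_eq0/polytime_subn. Qed.

Lemma polytime_andb (E : enctype) (a b : E -> bool) :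
  polytime a -> polytime b -> polytime (fun e => a e && b e).
Proof. by move=> pa pb; apply: polytime_if => //; exact: polytime_const. Qed.

Lemma polytime_orb (E : enctype) (a b : E -> bool) :
  polytime a -> polytime b -> polytime (fun e => a e || b e).
Proof. by move=> pa pb; apply: polytime_if => //; exact: polytime_const. Qed.

Lemma polytime_implb (E : enctype) (a b : E -> bool) :
  polytime a -> polytime b -> polytime (fun e => a e ==> b e).
Proof. by move=> pa pb; apply: polytime_if => //; exact: polytime_const. Qed.

Lemma polytime_eqb (E : enctype) (a b : E -> bool) :
  polytime a -> polytime b -> polytime (fun e => a e == b e).
Proof.
move=> pa pb; apply: polytime_ext (polytime_if pa pb (polytime_negb pb)) => e.
by case: (a e); case: (b e).
Qed.

Lemma polytime_eqn (E : enctype) (m n : E -> nat) :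
  polytime m -> polytime n -> polytime (fun e => m e == n e).
Proof.
move=> pm pn; apply: polytime_ext (polytime_andb (polytime_leq pm pn) (polytime_leq pn pm)) => e.
by rewrite eqn_leq.
Qed.

Lemma polytime_count (E A : enctype) (p : E -> A -> bool) (l : E -> seq A) :
  polytime (fun x : E * A => p x.1 x.2) -> polytime l ->
  polytime (fun e => count (p e) (l e)).
Proof.
move=> pp pl; apply: polytime_ext (polytime_size (polytime_filter pp pl)) => e.
by rewrite size_filter.
Qed.

Lemma csize_circuit (C : circuit) : csize C = (csize (inputs C) + csize (gates C)).+1.
Proof. by []. Qed.

Lemma polytime_inputs (E : enctype) (C : E -> circuit) :
  polytime C -> polytime (fun e => inputs (C e)).
Proof.
apply: (polytime_comp (g := inputs)); apply: (polytime_expr (e := EFst EVar)) => //.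
by apply: poly_leq (poly_csize _) => c; rewrite csize_circuit /=; lia.
Qed.

Lemma polytime_gates (E : enctype) (C : E -> circuit) :
  polytime C -> polytime (fun e => gates (C e)).
Proof.
apply: (polytime_comp (g := gates)); apply: (polytime_expr (e := ESnd EVar)) => //.
by apply: poly_leq (poly_csize _) => c; rewrite csize_circuit /=; lia.
Qed.

(** The tag used by [enc_gate]. With [fanin] it replaces case analysis on gates by operations that a
    program can perform. *)
Definition gate_tag (g : gate) : nat :=
  match g with Not _ => 0 | And _ => 1 | Or _ => 2 end.

Lemma polytime_gate_tag (E : enctype) (g : E -> gate) :
  polytime g -> polytime (fun e => gate_tag (g e)).
Proof.
apply: (polytime_comp (g := gate_tag)); apply: (polytime_expr (e := EFst EVar)); first by case.
by apply: poly_leq (poly_const _ 5); case=> *; rewrite /= csize_nat.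
Qed.

Lemma polytime_fanin (E : enctype) (g : E -> gate) :
  polytime g -> polytime (fun e => fanin (g e)).
Proof.
apply: (polytime_comp (g := fanin)).
(* Tag 0 is [Leaf], so the test fails exactly on [Not], whose bare wire has to be wrapped into a
   list of length one. *)
exists (If (EFst EVar) (Assign (ESnd EVar)) (Assign (ENode (ESnd EVar) ELeaf))).
exists (fun g => (csize g).+2); split; first by do 2!apply: poly_S; exact: poly_csize.
case=> [w|ws|ws] /=; rewrite /code /=.
- eexists; first by apply: run_if_false => //; exact: run_assign.
  by rewrite /csize /code /=; lia.
- eexists; first by apply: run_if_true => //; exact: (run_assign (ESnd EVar)).
  by rewrite /csize /code /=; lia.
- eexists; first by apply: run_if_true => //; exact: (run_assign (ESnd EVar)).
  by rewrite /csize /code /=; lia.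
Qed.

(** Descends through the syntax of the function; what has no rule is left as a goal. *)
Ltac polytime :=
  lazymatch goal with
  | |- polytime (fun e => (@?f e, @?g e)) => apply: polytime_pair; polytime
  | |- polytime (fun e => if _ then _ else _) => apply: polytime_if; polytime
  | |- polytime (fun e => (@?f e).1) => apply: polytime_fst; polytime
  | |- polytime (fun e => (@?f e).2) => apply: polytime_snd; polytime
  | |- polytime (fun e => _ :: _) => apply: polytime_cons; polytime
  | |- polytime (fun e => S _) => apply: polytime_succ; polytime
  | |- polytime (fun e => _ == _) =>
    first [apply: polytime_eqn | apply: polytime_eqb]; polytime
  | |- polytime (fun e => nilp _) => apply: polytime_nilp; polytime
  | |- polytime (fun e => ~~ _) => apply: polytime_negb; polytime
  | |- polytime (fun e => head _ _) => apply: polytime_head; polytime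
  | |- polytime (fun e => behead _) => apply: polytime_behead; polytime
  | |- polytime (fun e => nth _ _ _) => apply: polytime_nth; polytime
  | |- polytime (fun e => _ ++ _) => apply: polytime_cat; polytime
  | |- polytime (fun e => map _ _) => apply: polytime_map; polytime
  | |- polytime (fun e => flatten _) => apply: polytime_flatten; polytime
  | |- polytime (fun e => filter _ _) => apply: polytime_filter; polytime
  | |- polytime (fun e => has _ _) => apply: polytime_has; polytime
  | |- polytime (fun e => all _ _) => apply: polytime_all; polytime
  | |- polytime (fun e => count _ _) => apply: polytime_count; polytime
  | |- polytime (fun e => size _) => apply: polytime_size; polytime
  | |- polytime (fun e => rcons _ _) => apply: polytime_rcons; polytime
  | |- polytime (fun e => iota 0 _) => apply: polytime_iota; polytime
  | |- polytime (fun e => _ + _) => apply: polytime_addn; polytime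
  | |- polytime (fun e => _ - _) => apply: polytime_subn; polytime
  | |- polytime (fun e => _ * _) => apply: polytime_muln; polytime
  | |- polytime (fun e => _ ^ _) => apply: polytime_expn; polytime
  | |- polytime (fun e => predn _) => apply: polytime_pred; polytime
  | |- polytime (fun e => _ <= _) => apply: polytime_leq; polytime
  | |- polytime (fun e => _ && _) => apply: polytime_andb; polytime
  | |- polytime (fun e => _ || _) => apply: polytime_orb; polytime
  | |- polytime (fun e => _ ==> _) => apply: polytime_implb; polytime
  | |- polytime (fun e => inputs _) => apply: polytime_inputs; polytime
  | |- polytime (fun e => gates _) => apply: polytime_gates; polytime
  | |- polytime (fun e => gate_tag _) => apply: polytime_gate_tag; polytime
  | |- polytime (fun e => fanin _) => apply: polytime_fanin; polytime
  | |- _ =>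
    first [ assumption | exact: polytime_id | exact: polytime_const
          | exact: (polytime_fst (polytime_id _)) | exact: (polytime_snd (polytime_id _))
          | idtac ]
  end.

(** * The reduction *)

Lemma gate_valueE g vs : gate_value g vs =
  if gate_tag g == 0 then ~~ nth false vs (head 0 (fanin g))
  else if gate_tag g == 1 then all (nth false vs) (fanin g)
  else has (nth false vs) (fanin g).
Proof. by case: g. Qed.

Lemma size_wire_values T (step : gate -> seq T -> T) s gs :
  size (wire_values step s gs) = size s + size gs.
Proof.
rewrite /wire_values; elim/last_ind: gs => [|gs g IH] /=; first by rewrite addn0.
by rewrite foldl_rcons !size_rcons IH addnS.
Qed.

Lemma polytime_wire_values (E : enctype) (s : E -> seq bool) (gs : E -> seq gate) :
  polytime s -> polytime gs -> polytime (fun e => wire_values gate_value (s e) (gs e)).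
Proof.
move=> ps pg.
apply: (polytime_foldl (step := fun _ vs g => rcons vs (gate_value g vs))
          (bound := fun e => ((csize (s e) + csize (gs e)) * 4).+1)) => //.
- pose body (x : E * (gate * seq bool)) := rcons x.2.2
    (if gate_tag x.2.1 == 0 then ~~ nth false x.2.2 (head 0 (fanin x.2.1))
     else if gate_tag x.2.1 == 1 then all (nth false x.2.2) (fanin x.2.1)
     else has (nth false x.2.2) (fanin x.2.1)).
  apply: (@polytime_ext _ _ body) => [x|]; first by rewrite gate_valueE.
  rewrite /body; polytime.
- by apply: poly_S; apply: poly_mul (poly_const _ _); apply: poly_add; exact: polytime_csize.
- move=> e i; rewrite -/(wire_values gate_value (s e) (take i (gs e))).
  apply: leq_trans (csize_seq_leq (m := 3) _) _.
    by apply/allP => b _; exact: csize_bool.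
  rewrite ltnS leq_mul2r size_wire_values leq_add //.
    by rewrite ltnW // size_csize.
  by apply: leq_trans (ltnW (size_csize _)) (csize_take _ _).
Qed.

Definition gate_at (C : circuit) (w : nat) : gate :=
  nth (Not 0) (gates C) (w - inputs C).

(* A gate of fan-in above 2 is not unfolded further: in a circuit of weft 1 its
   inputs have weft 0.  The number [r] bounds the depth of [w]. *)
Fixpoint certificates (r : nat) (C : circuit) (w : nat) (s : bool) : seq (seq (nat * bool)) :=
  if w < inputs C then [:: [:: (w, s)]]
  else if r is r'.+1 then
    if gate_tag (gate_at C w) == 0 then
      certificates r' C (head 0 (fanin (gate_at C w))) (~~ s)
    else if (gate_tag (gate_at C w) == 1) == s then
      if size (fanin (gate_at C w)) <= 2 then
        [seq c1 ++ c2 | c1 <- certificates r' C (nth 0 (fanin (gate_at C w)) 0) s,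
                        c2 <- certificates r' C (nth 0 (fanin (gate_at C w)) 1) s]
      else [:: [seq (v, s) | v <- fanin (gate_at C w)]]
    else
      if size (fanin (gate_at C w)) <= 2 then
        flatten [seq certificates r' C v s | v <- fanin (gate_at C w)]
      else [seq [:: (v, s)] | v <- fanin (gate_at C w)]
  else [::].

(** The recursion on [r] takes place outside the machine: each fixed [r] has its own program, with
    its own polynomial. The environment [E] varies in the induction because recursive calls occur
    under binders, which enlarge it. *)
Lemma polytime_certificates r (E : enctype) (C : E -> circuit) (w : E -> nat) (s : E -> bool) :
  polytime C -> polytime w -> polytime s ->
  polytime (fun e => certificates r (C e) (w e) (s e)).
Proof.
elim: r E C w s => [|r IH] E C w s pC pw ps /=; first by polytime.
have pg : polytime (fun e => gate_at (C e) (w e)) by rewrite /gate_at; polytime.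
have p1 (A : enctype) (f : A -> E) : polytime f -> polytime (fun e => C (f e)).
  exact: polytime_comp.
have p2 (A : enctype) (f : A -> E) : polytime f -> polytime (fun e => gate_at (C (f e)) (w (f e))).
  exact: (polytime_comp pg).
have p3 (A : enctype) (f : A -> E) : polytime f -> polytime (fun e => s (f e)).
  exact: polytime_comp.
polytime; try apply: IH; polytime; try apply: p1; try apply: p2; try apply: p3; polytime.
Qed.

(** An input assignment is represented by the list [U] of the inputs set to true. *)
Definition wire_vals (C : circuit) (U : seq nat) : seq bool :=
  wire_values gate_value [seq has (eq_op i) U | i <- iota 0 (inputs C)] (gates C).

Definition violations (C : circuit) (c : seq (nat * bool)) (U : seq nat) : nat :=
  count (fun ws => nth false (wire_vals C U) ws.1 != ws.2) c.

Lemma polytime_violations (E : enctype) (C : E -> circuit) c U :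
  polytime C -> polytime c -> polytime U ->
  polytime (fun e => violations (C e) (c e) (U e)).
Proof.
move=> pC pc pU; rewrite /violations.
have pv : polytime (fun e => wire_vals (C e) (U e)).
  rewrite /wire_vals; apply: polytime_wire_values; polytime.
  by apply: polytime_comp pU _; polytime.
polytime.
by apply: polytime_comp pv _; polytime.
Qed.

(* The finite difference of [violations C c] along [T] at [U], as a difference of
   two natural numbers; correct when [size T <= r]. *)
Fixpoint differences (r : nat) (C : circuit) (c : seq (nat * bool)) (T U : seq nat) : nat * nat :=
  if r is r'.+1 then
    if nilp T then (violations C c U, 0)
    else ((differences r' C c (behead T) (head 0 T :: U)).1 +
            (differences r' C c (behead T) U).2,
          (differences r' C c (behead T) (head 0 T :: U)).2 +
            (differences r' C c (behead T) U).1)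
  else (violations C c U, 0).

Lemma polytime_differences r (E : enctype) (C : E -> circuit) c T U :
  polytime C -> polytime c -> polytime T -> polytime U ->
  polytime (fun e => differences r (C e) (c e) (T e) (U e)).
Proof.
elim: r T U => [|r IH] T U pC pc pT pU /=.
  by polytime; exact: polytime_violations.
have pv := polytime_violations pC pc pU.
by polytime; apply: IH; polytime.
Qed.

(** Each set of at most [r] numbers below [k] is represented once, as a decreasing list. *)
Fixpoint subsets (r k : nat) : seq (seq nat) :=
  if r is r'.+1 then
    [::] :: flatten [seq map (cons j) (subsets r' j) | j <- iota 0 k]
  else [:: [::]].

Lemma polytime_subsets r (E : enctype) (k : E -> nat) :
  polytime k -> polytime (fun e => subsets r (k e)).
Proof.
elim: r E k => [|r IH] E k pk /=; polytime; apply: IH; polytime.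
Qed.

(** [r] is fuel: all of [I] receives values when [size I <= r]. *)
Fixpoint assignments (r n : nat) (I : seq nat) : seq (seq (nat * nat)) :=
  if r is r'.+1 then
    if nilp I then [:: [::]]
    else [seq (head 0 I, x) :: b | x <- iota 0 n, b <- assignments r' n (behead I)]
  else [:: [::]].

Lemma polytime_assignments r (E : enctype) (n : E -> nat) (I : E -> seq nat) :
  polytime n -> polytime I -> polytime (fun e => assignments r (n e) (I e)).
Proof.
elim: r E n I => [|r IH] E n I pn pI /=; polytime.
- by apply: polytime_comp pI _; polytime.
- by apply: IH; polytime; [apply: polytime_comp pn _ | apply: polytime_comp pI _]; polytime.
Qed.

(** * The compatibility graph of partial solutions *)

Section Instance.
Variable d : nat.

(* At least 2, so that every two of the [k] positions share a slot, where their
   values are compared. *)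
Definition arity := (2 ^ d).+1.

Definition certs (C : circuit) : seq (seq (nat * bool)) :=
  certificates d C (inputs C + size (gates C)).-1 true.

Definition cert_at (C : circuit) (i : nat) := nth [::] (certs C) i.

Definition slots (k : nat) : nat := size (subsets arity k).

(* Partial sums start at this offset, which keeps them nonnegative. *)
Definition sum_bound (C : circuit) (k i : nat) : nat :=
  slots k * 2 ^ arity * size (cert_at C i).

(* [((i, j), (b, (p, q)))]: certificate [i], slot [j], values [b] of the positions
   in slot [j], partial sums [p] and [q] before and after slot [j]. *)
Definition candidate := ((nat * nat) * (seq (nat * nat) * (nat * nat)))%type.

Definition candidates (C : circuit) (k : nat) : seq candidate :=
  flatten [seq flatten [seq flatten [seq flatten [seq
    [seq ((i, j), (b, (p, q))) | q <- iota 0 (2 * sum_bound C k i).+1]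
      | p <- iota 0 (2 * sum_bound C k i).+1]
      | b <- assignments arity (inputs C) (nth [::] (subsets arity k) j)]
      | j <- iota 0 (slots k)]
      | i <- iota 0 (size (certs C))].

(** The first condition makes the values at distinct positions of the slot distinct. The second says
    that [q - p] is the finite difference along these values, with negative terms moved across. *)
Definition valid (C : circuit) (x : candidate) : bool :=
  all (fun a => all (fun b => (a.2 == b.2) ==> (a.1 == b.1)) x.2.1) x.2.1 &&
  (x.2.2.2 + (differences arity C (cert_at C x.1.1) [seq a.2 | a <- x.2.1] [::]).2 ==
   x.2.2.1 + (differences arity C (cert_at C x.1.1) [seq a.2 | a <- x.2.1] [::]).1).

(* Besides its slot, a vertex is a partial assignment of values to keys: key 0 is
   the certificate, key [j.+1] the partial sum before slot [j], and key
   [(slots k).+1 + i] the position [i].  The sum after the last slot is stored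
   under the key of the first one. *)
Definition vertex (k : nat) (x : candidate) : nat * seq (nat * nat) :=
  (x.1.2,
   [:: (0, x.1.1), (x.1.2.+1, x.2.2.1),
       ((if x.1.2.+1 == slots k then 0 else x.1.2.+1).+1, x.2.2.2)
     & [seq ((slots k).+1 + a.1, a.2) | a <- x.2.1]]).

Definition agree (v w : seq (nat * nat)) : bool :=
  all (fun a => all (fun b => (a.1 == b.1) ==> (a.2 == b.2)) w) v.

(** A vertex has to agree with itself: for [k = 0] there is one slot, the sums before and after it
    share a key, and no edge would compare them. *)
Definition vertices (C : circuit) (k : nat) : seq (nat * seq (nat * nat)) :=
  [seq v <- [seq vertex k x | x <- [seq x <- candidates C k | valid C x]] | agree v.2 v.2].

(** Since adjacent vertices have different slots, a clique with as many vertices as slots picks one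
    vertex for each slot. *)
Definition joined (v w : nat * seq (nat * nat)) : bool :=
  (v.1 != w.1) && agree v.2 w.2.

Lemma polytime_certs (E : enctype) (C : E -> circuit) :
  polytime C -> polytime (fun e => certs (C e)).
Proof. by move=> pC; apply: polytime_certificates; polytime. Qed.

Lemma polytime_cert_at (E : enctype) (C : E -> circuit) i :
  polytime C -> polytime i -> polytime (fun e => cert_at (C e) (i e)).
Proof. by move=> pC pi; rewrite /cert_at; polytime; exact: polytime_certs. Qed.

Lemma polytime_slots (E : enctype) (k : E -> nat) :
  polytime k -> polytime (fun e => slots (k e)).
Proof. by move=> pk; rewrite /slots; polytime; exact: polytime_subsets. Qed.

Lemma polytime_sum_bound (E : enctype) (C : E -> circuit) k i :
  polytime C -> polytime k -> polytime i ->
  polytime (fun e => sum_bound (C e) (k e) (i e)).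
Proof.
move=> pC pk pi; rewrite /sum_bound; polytime; first exact: polytime_slots.
exact: polytime_cert_at.
Qed.

Lemma polytime_agree (E : enctype) v w :
  polytime v -> polytime w -> polytime (fun e : E => agree (v e) (w e)).
Proof.
by move=> pv pw; rewrite /agree; polytime; apply: polytime_comp pw _; polytime.
Qed.

Lemma polytime_candidates (E : enctype) (C : E -> circuit) (k : E -> nat) :
  polytime C -> polytime k -> polytime (fun e => candidates (C e) (k e)).
Proof.
move=> pC pk; rewrite /candidates.
have pC' (A : enctype) (f : A -> E) : polytime f -> polytime (fun e => C (f e)).
  exact: polytime_comp.
have pk' (A : enctype) (f : A -> E) : polytime f -> polytime (fun e => k (f e)).
  exact: polytime_comp.
polytime; [| | | | exact: polytime_certs];
  try apply: polytime_sum_bound; try apply: polytime_assignments; try apply: polytime_slots;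
  polytime; try apply: polytime_subsets;
  try apply: pC'; try apply: pk'; try apply: polytime_inputs; try apply: pC'; polytime.
Qed.

Lemma polytime_valid (E : enctype) (C : E -> circuit) x :
  polytime C -> polytime x -> polytime (fun e => valid (C e) (x e)).
Proof.
move=> pC px; rewrite /valid; polytime.
- by apply: polytime_comp px _; polytime.
- by apply: polytime_differences; polytime; apply: polytime_cert_at; polytime.
- by apply: polytime_differences; polytime; apply: polytime_cert_at; polytime.
Qed.

Lemma polytime_vertices (E : enctype) (C : E -> circuit) (k : E -> nat) :
  polytime C -> polytime k -> polytime (fun e => vertices (C e) (k e)).
Proof.
move=> pC pk; rewrite /vertices.
have pk' (A : enctype) (f : A -> E) : polytime f -> polytime (fun e => k (f e)).
  exact: polytime_comp.
polytime.
- by apply: polytime_agree; polytime.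
- by rewrite /vertex; polytime; apply: polytime_slots; apply: pk'; polytime.
- by apply: polytime_valid; [apply: polytime_comp pC _ | ]; polytime.
- exact: polytime_candidates.
Qed.

Lemma polytime_joined (E : enctype) v w :
  polytime v -> polytime w -> polytime (fun e : E => joined (v e) (w e)).
Proof.
by move=> pv pw; rewrite /joined; polytime; apply: polytime_agree; polytime.
Qed.

End Instance.

(** * Composing reductions with polynomial-time maps *)

Lemma polytime_recode (A B A' B' : enctype) (f : A -> B) (f' : A' -> B') (h : A' -> A) :
  (forall a, code (h a) = code a) -> (forall a, code (f (h a)) = code (f' a)) ->
  polytime f -> polytime f'.
Proof.
move=> hc fc [p [b [[c bc] hp]]]; exists p, (b \o h); split.
  by exists c => a; have := bc (h a); rewrite /csize hc.
by move=> a; have := hp (h a); rewrite fc hc.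
Qed.

Definition inst_enctype (B : pproblem) : enctype := EncType (@enc B).

Lemma computable_polytime (h : nat * nat -> nat) (f : nat -> nat) :
  polytime h -> computable f -> computable (fun k => h (f k, k)).
Proof.
move=> [q [b [_ hq]]] [p hp].
exists (Seq (Assign (ENode EVar EVar)) (Seq (on_fst p) q)) => k.
have [t r] := hp k; have [t' r' _] := run_on_fst (enc_nat k) r.
have [u s _] := hq (f k, k); eexists.
by apply: run_seq (run_assign _ _) _; apply: run_seq r' s.
Qed.

(** The intermediate instance is at most as large as the input plus the time spent on it, so a
    polynomial in its size still splits into a function of [k] times a power of the input size.
    Monotonicity of [g] carries over the bound on the parameter. *)
Lemma fpt_reducible_polytime (A B C : pproblem) (f : inst B -> nat -> inst C) (g : nat -> nat) :
  polytime (fun x : inst_enctype B * nat => (f x.1 x.2 : inst_enctype C, g x.2)) ->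
  polytime g -> {homo g : m n / m <= n} ->
  (forall x k, yes x k <-> yes (f x k) (g k)) ->
  fpt_reducible A B -> fpt_reducible A C.
Proof.
move=> [q [b [[c2 hb] hq]]] pg gmono fyes [p [h [g1 [c [ch cg hp]]]]].
(* With [M] the product of [h k + k * 2 + 6] and [X ^ c.+1], the first program takes time at most
   [M] and the second at most [M ^ c2]. As [2 <= M], their sum is at most [M ^ c2.+2], whose factor
   depending on [k] is [F (h k, k)]. *)
pose F m := (m.1 + m.2 * 2 + 6) ^ c2.+2.
exists (Seq p q), (fun k => F (h k, k)), (fun k => g (g1 k)), (c.+1 * c2.+2).
split.
- by apply: computable_polytime ch; rewrite /F; polytime.
- apply: (@computable_polytime (fun m => g m.1)) cg.
  by apply: polytime_comp pg _; polytime.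
move=> x k; have [y [l [t [r lt ll yl]]]] := hp x k.
have [u s lu] := hq (y, l).
exists (f y l), (g l), (t + u); split.
- exact: run_seq r s.
- apply: leq_trans (leq_add lt (leq_trans lu (hb _))) _.
  rewrite expnM -expnMn /F /=.
  set X := dsize (enc x) in lt *; have X0 : 0 < X := dsize_gt0 _.
  have Xc : 0 < X ^ c by rewrite expn_gt0 X0.
  have sz : (csize ((y, l) : inst_enctype B * nat)).+1 <= (h k + k * 2 + 6) * X ^ c.+1.
    have := run_size r; rewrite -[dsize (Node (enc y) _)]/(csize ((y, l) : inst_enctype B * nat)).
    rewrite -[dsize (Node _ _)]/(X + csize k).+1 csize_nat expnS; move: lt.
    have : X <= X * X ^ c by rewrite leq_pmulr.
    have : h k * X ^ c <= h k * (X * X ^ c) by rewrite leq_mul2l leq_pmull ?orbT.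
    set Z := X * X ^ c; set H := h k * X ^ c; set H' := h k * Z; set Y := csize _.
    move=> *; have : X <= Z by []; have : 0 < Z by rewrite muln_gt0 X0.
    have -> : (h k + k * 2 + 6) * Z = H' + k * Z * 2 + 6 * Z by rewrite /H'; nia.
    have : k <= k * Z by nia.
    by move: (k * Z) => kZ; lia.
  set M := (h k + k * 2 + 6) * X ^ c.+1 in sz *.
  have tM : h k * X ^ c <= M.
    rewrite /M expnS; have : X ^ c <= X * X ^ c by rewrite leq_pmull.
    by move: (X * X ^ c) (X ^ c) => Z W; nia.
  have M2 : 2 <= M by apply: leq_trans sz; rewrite ltnS csize_gt0.
  have zM : (csize ((y, l) : inst_enctype B * nat)).+1 ^ c2 <= M ^ c2.
    by case: (c2) => // c3; rewrite leq_exp2r.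
  apply: leq_trans (leq_add tM zM) _; rewrite !expnS.
  have M0 : 0 < M := ltnW M2; have P0 : 0 < M ^ c2 by rewrite expn_gt0 M0.
  have := leq_mul M2 (leqnn (M * M ^ c2)).
  by have := leq_pmulr M P0; have := leq_pmull (M ^ c2) M0; lia.
- exact: gmono.
- by rewrite yl.
Qed.

(** * The temporal graph built from a graph *)

Section Gadget.
Variables (n : nat) (r : rel nat).

(** Vertex [i < n] is [a_i] and vertex [n + i] is [b_i]. The times of an arc depend only on its
    tail. *)
Definition gadget_edge : rel nat :=
  fun i j => if i < n then (n <= j) && ((j - n == i) || r i (j - n)) else j == i - n.

Definition gadget_times (i : nat) : seq nat := if i < n then [:: 2] else [:: 1; 3].

Definition gadget : tdigraph :=
  @TDigraph (n + n) 3 (fun i j => gadget_edge i j)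
    (fun i _ => [set t : 'I_3 | t.+1 \in gadget_times i]).

(** The arc list of the encoding over plain numbers instead of ordinals, in a form that list
    operations compute. *)
Definition gadget_list : seq ((nat * nat) * seq nat) :=
  [seq (uv, gadget_times uv.1)
     | uv <- [seq uv <- [seq (u, v) | u <- iota 0 (n + n), v <- iota 0 (n + n)]
                | gadget_edge uv.1 uv.2]].

Lemma enc_seq_map (A B : Type) (f : B -> data) (h : A -> B) s :
  enc_seq f (map h s) = enc_seq (f \o h) s.
Proof. by rewrite /enc_seq foldr_map. Qed.

Lemma eq_enc_seq (A : Type) (f g : A -> data) s : f =1 g -> enc_seq f s = enc_seq g s.
Proof. by move=> fg; elim: s => //= a s ->; rewrite fg. Qed.

Lemma enc_gadget : enc_tdigraph gadget = code (n + n, (3, gadget_list)).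
Proof.
rewrite /enc_tdigraph /=; congr (Node _ (Node _ _)).
rewrite /gadget_list -val_enum_ord.
have -> : [seq (u, v) | u <- map val (enum 'I_(n + n)), v <- map val (enum 'I_(n + n))] =
  [seq (val uv.1, val uv.2) | uv <- [seq (u, v) | u <- enum 'I_(n + n), v <- enum 'I_(n + n)]].
  by rewrite map_allpairs allpairs_mapl allpairs_mapr.
rewrite filter_map -map_comp; rewrite /code /= enc_seq_map.
apply: eq_enc_seq => -[u v] /=; congr (Node (Node _ _) _).
rewrite /code /= -[RHS]/(enc_seq (fun m => enc_nat m) _).
(* The times are increasing, so filtering 1, 2, 3 returns them in the order in which [enc_tdigraph]
   lists a label. *)
have {2}-> : gadget_times u = [seq m.+1 | m <- [seq m <- iota 0 3 | m.+1 \in gadget_times u]].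
  by rewrite /gadget_times; case: ifP.
rewrite -val_enum_ord filter_map -map_comp enc_seq_map; congr (foldr _ _ _).
by apply: eq_filter => t; rewrite inE.
Qed.
End Gadget.

(** * Cliques and components *)

(** Enlarging [X] shrinks its complement, so this can happen only finitely often. As [P] is an
    arbitrary proposition, deciding whether a larger set exists is classical. *)
Lemma inclusion_maximal_exists (V : finType) (P : {set V} -> Prop) X :
  P X -> exists2 Y, inclusion_maximal P Y & X \subset Y.
Proof.
have [m] := ubnP #|~: X|; elim: m X => // m IH X ltm PX.
have [[Y [PY XY]]|no] := classic (exists Y, P Y /\ X \proper Y).
  have [|Z PZ YZ] := IH Y _ PY.
    by apply: (@leq_trans #|~: X|) => //; apply: proper_card; rewrite properC.
  by exists Z => //; apply: subset_trans YZ; exact: proper_sub.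
exists X => //; split=> // Y PY XY; apply/eqP; rewrite eq_sym eqEproper XY /=.
by apply/negP => pXY; apply: no; exists Y.
Qed.

Definition has_clique (n : nat) (r : rel nat) (m : nat) : Prop :=
  exists s : seq nat, [/\ uniq s, all (gtn n) s, m <= size s &
    {in s &, forall v w, v != w -> r v w}].

Lemma count_mem_iota n (s : seq nat) : uniq s -> all (gtn n) s ->
  count (mem s) (iota 0 n) = size s.
Proof.
move=> us sn; rewrite -size_filter; apply/perm_size/uniq_perm => //.
  by rewrite filter_uniq // iota_uniq.
move=> i; rewrite mem_filter mem_iota /= add0n.
by case si: (i \in s) => //=; exact: (allP sn).
Qed.

Section GadgetCorrectness.
Variables (n : nat) (r : rel nat).
Hypothesis rC : symmetric r.
Local Notation G := (gadget n r).
Implicit Types (u v : 'I_(n + n)) (p : seq 'I_(n + n)) (ts : seq 'I_3).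

Definition base (i : nat) : nat := if i < n then i else i - n.

(** The part of [temporal_path] that is checked arc by arc, and hence passes to tails of the
    path. *)
Definition timed u p ts : bool :=
  [&& path (@edge G) u p, size ts == size p &
      all (fun et => et.2 \in @label G et.1.1 et.1.2) (zip (zip (u :: p) p) ts)].

Lemma timed_cons u v p (t : 'I_3) ts :
  timed u (v :: p) (t :: ts) =
  [&& gadget_edge n r u v, t.+1 \in gadget_times n u & timed v p ts].
Proof. by rewrite /timed /= inE eqSS -!andbA; do !bool_congr. Qed.

Lemma timed_nil u v p : timed u (v :: p) [::] = false.
Proof. by rewrite /timed /= andbF. Qed.

(** The ordinal 2 is time 3, when only arcs [b_w -> a_w] are available, and these keep the base. *)
Lemma timed_late u p ts :
  timed u p ts -> all (fun t : 'I_3 => 2 <= t) ts -> base (last u p) = base u.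
Proof.
elim: p u ts => [//|v p IH] u [|t ts]; first by rewrite timed_nil.
rewrite timed_cons => /and3P [euv tt tp] /= /andP [t2 /(IH _ _ tp) ->].
move: euv tt; rewrite /gadget_edge /gadget_times /base; case: ifP => un.
  by rewrite inE; case: t t2 => [[|[|[|]]]].
by move/eqP => ->; have -> : u - n < n by have := ltn_ord u; lia.
Qed.

Lemma sorted_above (t : 'I_3) ts :
  sorted leq (map val (t :: ts)) -> all (fun s : 'I_3 => t <= s) ts.
Proof. by move=> /(order_path_min leq_trans); rewrite all_map. Qed.

(* From [b_v] the next arc is at time 1 or 3, hence at time 3 once time 2 is
   reached, and no arc leaves [a_v] at time 3. *)
Lemma timed_mid u p ts : n <= u ->
  timed u p ts -> sorted leq (map val ts) -> all (fun t : 'I_3 => 1 <= t) ts ->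
  base (last u p) = base u.
Proof.
case: ts p => [|t ts] [|v p] // nu; first by rewrite timed_nil.
move=> up st /= /andP [t1 _]; apply: (timed_late up) => /=.
have t2 : 2 <= t.
  by move: up; rewrite timed_cons /gadget_times ltnNge nu /= => /and3P [_];
     case: t t1 {st} => [[|[|[|]]]].
by rewrite t2; apply: sub_all (sorted_above st) => s; exact: leq_trans.
Qed.

(** Initial arcs [b_w -> a_w] keep the base. The first arc [a_v -> b_w] is at time 2, and after it
    [timed_mid] excludes any further change. *)
Lemma timed_base u p ts : timed u p ts -> sorted leq (map val ts) ->
  base (last u p) = base u \/ r (base u) (base (last u p)).
Proof.
elim: p u ts => [|v p IH] u [|t ts] //; [by left | by rewrite timed_nil | ].
rewrite timed_cons => /and3P [euv tt tp] st.
have st' : sorted leq (map val ts) by apply: path_sorted st.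
move: euv tt; rewrite /gadget_edge /gadget_times; case: ifP => un.
  move=> /andP [nv adj]; rewrite inE eqSS => /eqP t1 /=.
  rewrite (timed_mid nv tp st'); last by have := sorted_above st; rewrite t1.
  rewrite /base un ltnNge nv /=.
  by case/orP: adj => [/eqP ->|ruv]; [left | right].
move=> /eqP vu _ /=; have <- : base v = base u; last exact: IH st'.
by rewrite /base un vu; have -> : u - n < n by have := ltn_ord u; lia.
Qed.

Lemma reaches_base X u v : @temporally_reaches_in G X u v ->
  base u = base v \/ r (base u) (base v).
Proof.
move=> [p [ts [/and5P [_ pp /eqP <- sz /andP [lb st]] _]]].
have /timed_base/(_ st) [->|] : timed u p ts by rewrite /timed pp sz.
  by left.
by right.
Qed.

Lemma sum_base (s : seq nat) : uniq s -> all (gtn n) s ->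
  \sum_(u < n + n) (base u \in s) = 2 * size s.
Proof.
move=> us sn; rewrite big_split_ord /= mul2n -addnn.
have sz : \sum_(i < n) (val i \in s) = size s.
  rewrite -(big_mkord xpredT (fun i => (i \in s) : nat)) /index_iota subn0.
  by rewrite -big_mkcond /= sum1_count count_mem_iota.
rewrite -{1 2}sz; congr (_ + _); apply: eq_bigr => i _; rewrite /base /=.
  by rewrite ltn_ord.
by rewrite ltnNge leq_addr /= addKn.
Qed.

(** All the paths needed are parts of [b_i -> a_i -> b_j -> a_j] at times 1, 2, 3. The cases [i = j]
    are separated where that path would repeat a vertex. *)
Lemma clique_reaches (s : seq nat) (X := [set u : 'I_(n + n) | base u \in s]) u v :
  {in s &, forall i j, i != j -> r i j} -> u \in X -> v \in X ->
  @temporally_reaches_in G X u v.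
Proof.
move=> cs; rewrite !inE => us vs.
pose t0 : 'I_3 := @Ordinal 3 0 isT; pose t1 : 'I_3 := @Ordinal 3 1 isT.
pose t2 : 'I_3 := @Ordinal 3 2 isT.
have bl (i : 'I_n) : base (lshift n i) = i by rewrite /base /= ltn_ord.
have br (i : 'I_n) : base (rshift n i) = i by rewrite /base /= ltnNge leq_addr /= addKn.
have el (i j : 'I_n) : val i \in s -> val j \in s -> gadget_edge n r (lshift n i) (rshift n j).
  move=> si sj; rewrite /gadget_edge /= ltn_ord leq_addr addKn eq_sym /=.
  by case: eqVneq => //= ij; exact: cs.
have er (i : 'I_n) : gadget_edge n r (rshift n i) (lshift n i).
  by rewrite /gadget_edge /= ltnNge leq_addr /= addKn.
have tl (i : 'I_n) : gadget_times n (lshift n i) = [:: 2].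
  by rewrite /gadget_times /= ltn_ord.
have tr (i : 'I_n) : gadget_times n (rshift n i) = [:: 1; 3].
  by rewrite /gadget_times /= ltnNge leq_addr.
have reach p ts : uniq (u :: p) -> last u p == v -> timed u p ts ->
    sorted leq (map val ts) -> all (fun w : 'I_(n + n) => base w \in s) p ->
    @temporally_reaches_in G X u v.
  move=> up lp /and3P [pp sz lb] st ps; exists p, ts; split.
    by apply/and5P; split=> //; apply/andP.
  by move=> w; rewrite !inE => /predU1P [->|/(allP ps)].
have R := (eq_lshift, eq_rshift, eq_lrshift, eq_rlshift, timed_cons, tl, tr, er, el, bl, br).
case: (split_ordP u) reach us => i -> reach; rewrite (bl, br) => si;
case: (split_ordP v) reach vs => j -> reach; rewrite (bl, br) => sj.
- have [ij|/negbTE ij] := eqVneq i j; first by apply: (reach [::] [::]); rewrite //= ij.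
  by apply: (reach [:: rshift n j; lshift n j] [:: t1; t2]);
     rewrite /= ?mem_seq2 ?mem_seq1 ?R ?si ?sj ?ij.
- by apply: (reach [:: rshift n j] [:: t1]); rewrite /= ?mem_seq1 ?R ?si ?sj.
- have [ij|/negbTE ij] := eqVneq i j.
    by apply: (reach [:: lshift n j] [:: t0]); rewrite /= ?mem_seq1 ?ij ?R ?si ?sj.
  by apply: (reach [:: lshift n i; rshift n j; lshift n j] [:: t0; t1; t2]);
     rewrite /= ?mem_seq3 ?mem_seq2 ?mem_seq1 ?R ?si ?sj ?ij.
- have [ij|/negbTE ij] := eqVneq i j; first by apply: (reach [::] [::]); rewrite //= ij.
  by apply: (reach [:: lshift n i; rshift n j] [:: t0; t1]);
     rewrite /= ?mem_seq2 ?mem_seq1 ?R ?si ?sj ?ij.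
Qed.

(** Both kinds of component are treated at once. One direction uses only unilateral reachability,
    because [r] is symmetric; in the other the set found satisfies the stronger, two-way
    condition. *)
Lemma clique_component (P : {set 'I_(n + n)} -> Prop) m :
  (forall X, @closed_tc_set G X -> P X) -> (forall X, P X -> @closed_tuc_set G X) ->
  (exists X, inclusion_maximal P X /\ 2 * m <= #|X|) <-> has_clique n r m.
Proof.
move=> tcP Ptuc; split=> [[X [[/Ptuc PX _] mX]]|[s [us sn ms cs]]].
- pose s := [seq i <- iota 0 n | [exists u in X, base u == i]].
  have us : uniq s by rewrite filter_uniq // iota_uniq.
  have sn : all (gtn n) s.
    by apply/allP => i; rewrite mem_filter mem_iota => /and3P [].
  have Xs u : u \in X -> base u \in s.
    move=> uX; rewrite mem_filter mem_iota /= add0n; apply/andP; split.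
      by apply/existsP; exists u; rewrite uX /=.
    by rewrite /base; case: (ltnP u n) => // un; have := ltn_ord u; lia.
  exists s; split=> //.
  (* At most two vertices of [X] lie over each element of [s]. *)
  + rewrite -(leq_pmul2l (ltn0Sn 1)); apply: leq_trans mX _.
    rewrite -(sum_base us sn) -sum1_card big_mkcond /=; apply: leq_sum => u _.
    by case: ifP => // /Xs ->.
  + move=> i j; rewrite !mem_filter => /andP [/exists_inP [u uX /eqP <-] _].
    move=> /andP [/exists_inP [v vX /eqP <-] _] ne.
    case: (PX u v uX vX) => /reaches_base [e|] //; last by rewrite rC.
      by rewrite e eqxx in ne.
    by rewrite e eqxx in ne.
- pose X := [set u : 'I_(n + n) | base u \in s].
  have [|Y mY XY] := @inclusion_maximal_exists _ P X.
    by apply: tcP => u v uX vX; split; exact: clique_reaches.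
  exists Y; split=> //; apply: leq_trans (subset_leq_card XY).
  apply: (@leq_trans (2 * size s)); first by rewrite leq_mul2l.
  rewrite -(sum_base us sn) -sum1_card [leqRHS]big_mkcond /= leq_eqVlt; apply/orP; left.
  by apply/eqP; apply: eq_bigr => u _; rewrite inE; case: (_ \in s).
Qed.
End GadgetCorrectness.

Lemma closed_TCC_gadget n r m : symmetric r ->
  (exists X, closed_TCC (G := gadget n r) X /\ 2 * m <= #|X|) <-> has_clique n r m.
Proof.
move=> rC; apply: clique_component => // X tc u v uX vX.
by have [] := tc u v uX vX; left.
Qed.

Lemma closed_TUCC_gadget n r m : symmetric r ->
  (exists X, closed_TUCC (G := gadget n r) X /\ 2 * m <= #|X|) <-> has_clique n r m.
Proof.
move=> rC; apply: clique_component => // X tc u v uX vX.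
by have [] := tc u v uX vX; left.
Qed.

(** * Violations as a multilinear polynomial *)

(** A gate only appends its value, so later gates do not affect earlier wires. *)
Lemma take_wire_values T (step : gate -> seq T -> T) s gs i :
  i <= size gs ->
  take (size s + i) (wire_values step s gs) = wire_values step s (take i gs).
Proof.
have fp vs hs : take (size vs)
    (foldl (fun vs g => rcons vs (step g vs)) vs hs) = vs.
  elim: hs vs => [|h hs IH] vs /=; first by rewrite take_size.
  have := IH (rcons vs (step h vs)); set F := foldl _ _ _ => FE.
  have <- : take (size vs) (take (size (rcons vs (step h vs))) F) = take (size vs) F.
    by rewrite take_takel ?size_rcons.
  by rewrite FE -cats1 take_size_cat.
move=> li; rewrite -{1}(cat_take_drop i gs) /wire_values foldl_cat.
set vs := foldl _ s _; have -> : size s + i = size vs by rewrite size_wire_values size_takel.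
exact: fp.
Qed.

(** * Wire values, depth, weft and certificates *)

Section Wires.
Variable C : circuit.
Local Notation n := (inputs C).
Local Notation N := (inputs C + size (gates C)).

Lemma fanin_ltn w : n <= w < N -> all (gtn w) (fanin (gate_at C w)).
Proof.
move=> /andP [nw wN]; have wi : w - n < size (gates C) by lia.
have /and3P [_ _ /forallP /(_ (Ordinal wi)) /= h] := circuitP C.
by apply: sub_all h => v /=; rewrite subnKC.
Qed.

Lemma gate_at_ok w : n <= w < N -> gate_ok (gate_at C w).
Proof.
move=> /andP [nw wN]; have wi : w - n < size (gates C) by lia.
have /and3P [_ h _] := circuitP C.
exact: (all_nthP (Not 0) h).
Qed.

(** Without inputs there would be a first gate, and it would have to read a wire numbered below
    0. *)
Lemma inputs_gt0 : 0 < n.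
Proof.
have /and3P [N0 ok /forallP h] := circuitP C.
case n0: n N0 ok h => //=; case: (gates C) => //= g gs _ /andP [gok _].
by move=> /(_ ord0); case: g gok => [w|[|w ws]|[|w ws]].
Qed.

(** A gate reads only wires before it, so the final list can replace the prefix present when the
    gate was evaluated. Truth values, depth and weft are all instances. *)
Lemma nth_wire_values T x0 (step : gate -> seq T -> T) s w :
  size s = n ->
  (forall g vs1 vs2, {in fanin g, nth x0 vs1 =1 nth x0 vs2} -> step g vs1 = step g vs2) ->
  n <= w < N ->
  nth x0 (wire_values step s (gates C)) w =
  step (gate_at C w) (wire_values step s (gates C)).
Proof.
move=> sn local hw; have /andP [nw wN] := hw.
have wi : w - n < size (gates C) by lia.
have tw := take_wire_values step s (ltnW wi).
rewrite sn subnKC // in tw.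
transitivity (step (gate_at C w) (wire_values step s (take (w - n) (gates C)))).
  rewrite -(nth_take (n0 := w.+1)) //.
  have := take_wire_values step s wi; rewrite sn addnS subnKC // => ->.
  rewrite (take_nth (Not 0)) // -/(gate_at C w) /wire_values foldl_rcons nth_rcons.
  rewrite -/(wire_values step s (take (w - n) (gates C))) size_wire_values sn.
  by rewrite size_takel ?(ltnW wi) // subnKC // ltnn eqxx.
apply: local => v vf; rewrite -tw nth_take //.
exact: (allP (fanin_ltn hw)).
Qed.

Lemma nth_wire_input T x0 (step : gate -> seq T -> T) s w :
  size s = n -> w < n -> nth x0 (wire_values step s (gates C)) w = nth x0 s w.
Proof.
move=> sn wn; have := take_wire_values step s (leq0n (size (gates C))).
by rewrite addn0 take0 /= => {2}<-; rewrite nth_take ?sn.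
Qed.

Definition wire_val (U : seq nat) (w : nat) : bool := nth false (wire_vals C U) w.

Lemma wire_val_input U w : w < n -> wire_val U w = (w \in U).
Proof.
move=> wn; rewrite /wire_val nth_wire_input ?size_map ?size_iota //.
rewrite (nth_map 0) ?size_iota // nth_iota // add0n.
by apply/hasP/idP => [[v vU /eqP ->] //|wU]; exists w.
Qed.

Lemma gate_value_eq g vs1 vs2 :
  {in fanin g, nth false vs1 =1 nth false vs2} -> gate_value g vs1 = gate_value g vs2.
Proof.
case: g => [w|ws|ws] h /=; first by rewrite h ?mem_head.
  exact: eq_in_all.
exact: eq_in_has.
Qed.

Lemma wire_val_gate U w : n <= w < N ->
  wire_val U w = gate_value (gate_at C w) (wire_vals C U).
Proof.
by apply: nth_wire_values; [rewrite size_map size_iota | exact: gate_value_eq].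
Qed.

Definition wire_path (weight : gate -> nat) (w : nat) : nat :=
  nth 0 (wire_values (fun g vs => weight g + \max_(v <- fanin g) nth 0 vs v)
           (nseq n 0) (gates C)) w.

Lemma wire_path_gate weight w : n <= w < N ->
  wire_path weight w = weight (gate_at C w) + \max_(v <- fanin (gate_at C w)) wire_path weight v.
Proof.
apply: nth_wire_values; first by rewrite size_nseq.
move=> g vs1 vs2 h; congr (_ + _); rewrite big_seq [RHS]big_seq.
by apply: eq_bigr => v /h.
Qed.

Lemma wire_path_fanin weight w v : n <= w < N -> v \in fanin (gate_at C w) ->
  weight (gate_at C w) + wire_path weight v <= wire_path weight w.
Proof.
by move=> hw vf; rewrite (wire_path_gate _ hw) leq_add2l; apply: (leq_bigmax_seq v).
Qed.

Lemma longest_pathE weight : longest_path weight C = wire_path weight N.-1.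
Proof. by rewrite /longest_path -nth_last size_wire_values size_nseq. Qed.

Lemma out_ltn : N.-1 < N.
Proof. by have := inputs_gt0; lia. Qed.

Definition wire_depth := wire_path (fun=> 1).
Definition wire_weft := wire_path (fun g => 2 < size (fanin g)).

(** Certificates form a disjunction of conjunctions obtained by unfolding gates, so the equivalence
    holds gate by gate and for any weft. A bound on the weft enters only in [certificates_small]. *)
Lemma certificates_correct U r w s : w < N -> wire_depth w <= r ->
  has (fun c => violations C c U == 0) (certificates r C w s) = (wire_val U w == s).
Proof.
have viol1 v t : (violations C [:: (v, t)] U == 0) = (wire_val U v == t).
  by rewrite /violations /= addn0 eqb0 negbK.
have viol_cat c1 c2 : (violations C (c1 ++ c2) U == 0) =
    (violations C c1 U == 0) && (violations C c2 U == 0).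
  by rewrite /violations count_cat addn_eq0.
have viol_map vs t : (violations C [seq (v, t) | v <- vs] U == 0) =
    all (fun v => wire_val U v == t) vs.
  by elim: vs => [|v vs IHv] //; rewrite map_cons -cat1s viol_cat viol1 IHv.
elim: r w s => [|r IH] w s wN.
  rewrite /=; case: ltnP => [_ _|nw]; first by rewrite /= orbF viol1.
  by rewrite /wire_depth wire_path_gate ?nw.
move=> dw /=; case: ltnP => nw; first by rewrite /= orbF viol1.
have hw : n <= w < N by rewrite nw.
have fN v : v \in fanin (gate_at C w) -> v < N.
  by move=> /(allP (fanin_ltn hw)) /= vw; exact: ltn_trans wN.
have fd v : v \in fanin (gate_at C w) -> wire_depth v <= r.
  by move=> /(wire_path_fanin (fun=> 1) hw); rewrite /wire_depth in dw *; lia.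
have ok := gate_at_ok hw; rewrite (wire_val_gate U hw).
(* Conjunctive case: an [And] required to be true, or an [Or] required to be false. *)
have conj ws t : fanin (gate_at C w) = ws -> 1 < size ws ->
  has (fun c => violations C c U == 0)
   (if size ws <= 2 then
        [seq c1 ++ c2 | c1 <- certificates r C (nth 0 ws 0) t,
                        c2 <- certificates r C (nth 0 ws 1) t]
      else [:: [seq (v, t) | v <- ws]]) = all (fun v => wire_val U v == t) ws.
  move=> fE s1; rewrite fE in fN fd.
  case: ifP => s2; last by rewrite /= orbF viol_map.
  case: ws s1 s2 fN fd {fE} => [|v1 [|v2 [|v3 ws]]] //= _ _ fN fd.
  rewrite -(IH v1) -1?(IH v2) ?fN ?fd ?inE ?eqxx ?orbT // andbT.
  apply/hasP/andP => [[c /allpairsP [[c1 c2] [/= m1 m2 ->]]]|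
                      [/hasP [c1 m1 v1'] /hasP [c2 m2 v2']]].
    by rewrite viol_cat => /andP [z1 z2]; split; apply/hasP; [exists c1 | exists c2].
  exists (c1 ++ c2); last by rewrite viol_cat v1' v2'.
  by apply/allpairsP; exists (c1, c2).
(* Disjunctive case: an [Or] required to be true, or an [And] required to be false. *)
have disj ws t : fanin (gate_at C w) = ws ->
  has (fun c => violations C c U == 0)
   (if size ws <= 2 then flatten [seq certificates r C v t | v <- ws]
      else [seq [:: (v, t)] | v <- ws]) = has (fun v => wire_val U v == t) ws.
  move=> fE; rewrite fE in fN fd; case: ifP => s2; last first.
    by rewrite has_map; apply: eq_has => v /=; rewrite viol1.
  elim: ws fN fd {fE s2} => //= v ws IHw fN fd; rewrite has_cat IH ?fN ?fd ?mem_head // IHw //.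
  - by move=> u uw; rewrite fN // inE uw orbT.
  - by move=> u uw; rewrite fd // inE uw orbT.
case: (gate_at C w) ok fN fd conj disj => [v|ws|ws] /= ok fN fd conj disj.
- rewrite IH ?fN ?fd ?mem_head // /wire_val.
  by case: (nth _ _ _); case: (s).
- case/andP: ok => _ s1; case: s => /=; [rewrite conj // | rewrite disj //].
  + by rewrite eqb_id; apply: eq_all => v; rewrite eqb_id.
  + by rewrite eqbF_neg -has_predC; apply: eq_has => v; rewrite eqbF_neg.
- case/andP: ok => _ s1; case: s => /=; [rewrite disj // | rewrite conj //].
  + by rewrite eqb_id; apply: eq_has => v; rewrite eqb_id.
  + by rewrite eqbF_neg -all_predC; apply: eq_all => v; rewrite eqbF_neg.
Qed.

(** Unfolding ends at an input, of weft 0, or at a gate of fan-in above 2. That gate already uses up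
    the weft 1, which leaves 0 for the wires it reads. *)
Lemma certificates_small d r w s c x : w < N -> wire_depth w <= d -> wire_weft w <= 1 ->
  c \in certificates r C w s -> x \in c ->
  [/\ x.1 < N, wire_depth x.1 <= d & wire_weft x.1 = 0].
Proof.
have inp v : v < n -> [/\ v < N, wire_depth v <= d & wire_weft v = 0].
  move=> vn; rewrite /wire_depth /wire_weft /wire_path !nth_wire_input ?size_nseq //.
  by rewrite nth_nseq vn; split=> //; lia.
elim: r w s c => [|r IH] w s c wN dw ww /=; case: ltnP => nw //.
- by rewrite inE => /eqP ->; rewrite inE => /eqP -> /=; exact: inp.
- by rewrite inE => /eqP ->; rewrite inE => /eqP -> /=; exact: inp.
have hw : n <= w < N by rewrite nw.
have fv v : v \in fanin (gate_at C w) ->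
    [/\ v < N, wire_depth v <= d & (2 < size (fanin (gate_at C w))) + wire_weft v <= 1].
  move=> vf; have /= vw := allP (fanin_ltn hw) v vf; split.
  - exact: ltn_trans wN.
  - have := wire_path_fanin (fun=> 1) hw vf; rewrite /wire_depth in dw *; lia.
  - exact: leq_trans (wire_path_fanin (fun g => 2 < size (fanin g)) hw vf) ww.
have small v t c' : v \in fanin (gate_at C w) -> c' \in certificates r C v t -> x \in c' ->
    [/\ x.1 < N, wire_depth x.1 <= d & wire_weft x.1 = 0].
  by move=> /fv [vN dv wv]; apply: IH => //; apply: leq_trans wv; exact: leq_addl.
have big v : v \in fanin (gate_at C w) -> (size (fanin (gate_at C w)) <= 2) = false ->
    [/\ v < N, wire_depth v <= d & wire_weft v = 0].
  by move=> /fv [vN dv wv] /negbT; rewrite -ltnNge => s2; rewrite s2 in wv; split=> //; lia.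
have ok := gate_at_ok hw.
case: ifP => [|tag0].
  case: (gate_at C w) small {fv big ok} => //= v small _; apply: small; exact: mem_head.
have s1 : 1 < size (fanin (gate_at C w)).
  by case: (gate_at C w) ok tag0 => //= ws /andP [].
case: ifP => _; case: ifP => s2.
- move=> /allpairsP [[c1 c2] [/= m1 m2 ->]]; rewrite mem_cat => /orP [] xc.
    by apply: small m1 xc; rewrite mem_nth // ltnW.
  by apply: small m2 xc; rewrite mem_nth.
- by rewrite inE => /eqP -> /mapP [v vf ->]; exact: big.
- by move=> /flattenP [cs /mapP [v vf ->]]; exact: small.
- by move=> /mapP [v vf ->]; rewrite inE => /eqP ->; exact: big.
Qed.
End Wires.

(** * Multilinear polynomials and finite differences *)

Local Open Scope ring_scope.

(** A pair in [ms] is a coefficient with a monomial, given by its list of 0/1 variables. Repetitions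
    in the list are harmless because such variables are idempotent. *)
Definition multilinear (D : nat) (f : seq nat -> int) : Prop :=
  exists2 ms : seq (int * seq nat), all (fun m => (size m.2 <= D)%N) ms &
    forall U, f U = \sum_(m <- ms) m.1 * (all (mem U) m.2)%:R.

Lemma eq_multilinear D f g : f =1 g -> multilinear D f -> multilinear D g.
Proof. by move=> fg [ms ml fE]; exists ms => // U; rewrite -fg. Qed.

Lemma multilinear_leq D1 D2 f : (D1 <= D2)%N -> multilinear D1 f -> multilinear D2 f.
Proof.
move=> le [ms ml fE]; exists ms => //; apply: sub_all ml => m /= h; exact: leq_trans h le.
Qed.

Lemma multilinear_const D c : multilinear D (fun=> c).
Proof. by exists [:: (c, [::])] => // U; rewrite big_seq1 mulr1. Qed.

Lemma multilinear_mem D v : (0 < D)%N -> multilinear D (fun U => (v \in U)%:R).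
Proof. by exists [:: (1, [:: v])] => [/=|U]; rewrite ?andbT // big_seq1 mul1r /= andbT. Qed.

Lemma multilinearD D f g :
  multilinear D f -> multilinear D g -> multilinear D (fun U => f U + g U).
Proof.
move=> [ms ml fE] [ns nl gE]; exists (ms ++ ns); first by rewrite all_cat ml.
by move=> U; rewrite big_cat fE gE.
Qed.

Lemma multilinearM D1 D2 f g :
  multilinear D1 f -> multilinear D2 g -> multilinear (D1 + D2) (fun U => f U * g U).
Proof.
move=> [ms ml fE] [ns nl gE].
exists [seq (m.1 * n.1, m.2 ++ n.2) | m <- ms, n <- ns].
  apply/allP => _ /allpairsP [[m n] [/= mms nns ->]] /=.
  by rewrite size_cat leq_add // ?(allP ml) ?(allP nl).
move=> U; rewrite big_allpairs_dep fE gE mulr_suml; apply: eq_bigr => m _.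
rewrite mulr_sumr; apply: eq_bigr => n _ /=.
by rewrite all_cat mulrACA -natrM mulnb.
Qed.

Lemma multilinearN D f : multilinear D f -> multilinear D (fun U => - f U).
Proof.
move=> fD; apply: eq_multilinear (@multilinearM 0 D _ _ (multilinear_const 0 (-1)) fD) => U.
by rewrite mulN1r.
Qed.

(** Gates of weft 0 have fan-in at most 2 and act as [1 - x], [x * y] and [x + y - x * y], so each
    level at most doubles the degree. *)
Lemma multilinear_wire C D w : (w < inputs C + size (gates C))%N ->
  (wire_depth C w <= D)%N -> wire_weft C w = 0%N ->
  multilinear (2 ^ D) (fun U => (wire_val C U w)%:R).
Proof.
have inp U v : (v < inputs C)%N -> (v \in U)%:R = (wire_val C U v)%:R :> int.
  by move=> vn; rewrite wire_val_input.
have e0 E : (0 < 2 ^ E)%N by rewrite expn_gt0.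
elim: D w => [|D IH] w wN dw ww; case: (ltnP w (inputs C)) => nw.
- by apply: eq_multilinear (multilinear_mem w (e0 _)) => U; rewrite inp.
- by move: dw; rewrite /wire_depth wire_path_gate ?nw.
- by apply: eq_multilinear (multilinear_mem w (e0 _)) => U; rewrite inp.
have hw : (inputs C <= w < inputs C + size (gates C))%N by rewrite nw.
have fm v : v \in fanin (gate_at C w) -> multilinear (2 ^ D) (fun U => (wire_val C U v)%:R).
  move=> vf; apply: IH.
  - by have /= vw := allP (fanin_ltn hw) v vf; exact: ltn_trans wN.
  - by have := wire_path_fanin (fun=> 1%N) hw vf; rewrite /wire_depth in dw *; lia.
  - have := wire_path_fanin (fun g => (2 < size (fanin g))%N : nat) hw vf.
    by rewrite /wire_weft in ww *; lia.
have s2 : (size (fanin (gate_at C w)) <= 2)%N.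
  by move: ww; rewrite /wire_weft wire_path_gate // => /eqP; rewrite addn_eq0 eqb0 -leqNgt => /andP [].
have ok := gate_at_ok hw.
rewrite expnS mul2n -addnn.
case gE: (gate_at C w) ok s2 fm => [v|ws|ws] /= ok s2 fm.
- have vm := multilinearN (fm v (mem_head _ _)).
  apply: eq_multilinear (multilinear_leq (leq_addl _ _) (multilinearD (multilinear_const _ 1) vm)) => U.
  by rewrite (wire_val_gate _ hw) gE /= -/(wire_val C U v); case: wire_val; rewrite ?subr0 ?subrr.
- case: ws gE ok s2 fm => [|v1 [|v2 [|v3 ws]]] //= gE _ _ fm.
  have m1 : multilinear _ _ := fm v1 (mem_head _ _).
  have m2 : multilinear _ _ := fm v2 (mem_last v1 [:: v2]).
  apply: eq_multilinear (multilinearM m1 m2) => U.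
  rewrite (wire_val_gate _ hw) gE /= -!/(wire_val C U _) andbT.
  by case: wire_val; case: wire_val; rewrite ?mulr0 ?mul0r ?mulr1.
- case: ws gE ok s2 fm => [|v1 [|v2 [|v3 ws]]] //= gE _ _ fm.
  have m1 : multilinear _ _ := fm v1 (mem_head _ _).
  have m2 : multilinear _ _ := fm v2 (mem_last v1 [:: v2]).
  have m12 := multilinearD (multilinear_leq (leq_addl (2 ^ D)%N _) m1)
                         (multilinear_leq (leq_addl (2 ^ D)%N _) m2).
  apply: eq_multilinear (multilinearD m12 (multilinearN (multilinearM m1 m2))) => U.
  rewrite (wire_val_gate _ hw) gE /= -!/(wire_val C U _) orbF.
  by case: wire_val; case: wire_val; rewrite ?mulr0 ?mul0r ?mulr1 ?addr0 ?subr0 ?add0r ?addrK.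
Qed.

(** A requirement is violated to the extent [1 - x] or [x], and adding these up does not raise the
    degree, however long the certificate is. *)
Lemma multilinear_violations C D c :
  (forall x, x \in c -> [/\ (x.1 < inputs C + size (gates C))%N,
     (wire_depth C x.1 <= D)%N & wire_weft C x.1 = 0%N]) ->
  multilinear (2 ^ D) (fun U => (violations C c U)%:R).
Proof.
elim: c => [|[w s] c IH] hc; first exact: multilinear_const.
have [/= wN dw ww] := hc (w, s) (mem_head _ _).
have /IH mc : forall x, x \in c -> [/\ (x.1 < inputs C + size (gates C))%N,
     (wire_depth C x.1 <= D)%N & wire_weft C x.1 = 0%N].
  by move=> x xc; apply: hc; rewrite inE xc orbT.
have mw := multilinear_wire wN dw ww.
have ms : multilinear (2 ^ D) (fun U => (wire_val C U w != s)%:R).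
  case: s {hc}.
    apply: eq_multilinear (multilinearD (multilinear_const _ 1) (multilinearN mw)) => U.
    by case: wire_val; rewrite ?subr0 ?subrr.
  by apply: eq_multilinear mw => U; case: wire_val.
by apply: eq_multilinear (multilinearD ms mc) => U; rewrite /violations /= natrD.
Qed.

Fixpoint difference (f : seq nat -> int) (T U : seq nat) : int :=
  if T is x :: T' then difference f T' (x :: U) - difference f T' U else f U.

(** The difference along [x] annihilates a monomial if [x] is not among its variables or is already
    in [U]; otherwise it removes the variable [x]. *)
Lemma difference_monomial V T U : uniq T ->
  difference (fun U => (all (mem U) V)%:R) T U =
  [&& ~~ has (mem U) T, all (mem V) T & all (mem (T ++ U)) V]%:R.
Proof.
elim: T U => [|x T IH] U //= /andP [xT uT]; rewrite !IH //.
have -> : has (mem (x :: U)) T = has (mem U) T.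
  by apply: eq_in_has => y yT; rewrite !inE; case: eqP => // yx; rewrite -yx yT in xT.
have -> : all (mem (T ++ x :: U)) V = all (mem (x :: T ++ U)) V.
  by apply: eq_all => y /=; rewrite !(inE, mem_cat) orbCA.
rewrite negb_or; case: (has (mem U) T) => /=; first by rewrite !andbF subrr.
case: (all (mem V) T) => /=; last by rewrite !andbF subrr.
rewrite andbT !andbA.
have [h|/allPn [y yV yn]] := boolP (all (mem (T ++ U)) V).
  have -> : all (mem (x :: T ++ U)) V.
    by apply: sub_all h => y /=; rewrite inE => ->; rewrite orbT.
  rewrite subrr andbT; case xU: (x \in U) => //=; case xV: (x \in V) => //.
  by have := allP h x xV; rewrite /= mem_cat xU (negbTE xT).
have {}yn : y \notin T ++ U := yn.
rewrite subr0; case h: (all (mem (x :: T ++ U)) V); last by rewrite andbF.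
rewrite andbT; have := allP h y yV; rewrite /= inE (negbTE yn) orbF => /eqP yx.
by rewrite -yx yV andbT; move: yn; rewrite /= mem_cat yx negb_or => /andP [_ ->].
Qed.

(** By [difference_monomial] a monomial contributes only if its variables include all of [T], which
    is too large for that. *)
Lemma difference_vanish D f T U :
  multilinear D f -> uniq T -> (D < size T)%N -> difference f T U = 0.
Proof.
move=> [ms ml fE] uT sT.
have -> : difference f T U =
    \sum_(m <- ms) m.1 * difference (fun U => (all (mem U) m.2)%:R) T U.
  elim: T U {uT sT} => [|x T IH] U /=; first exact: fE.
  by rewrite !IH -sumrB; apply: eq_bigr => m _; rewrite mulrBr.
rewrite big_seq big1 // => m mms; rewrite difference_monomial //.
case: and3P => [[_ /allP TV _]|]; last by rewrite mulr0.
have := uniq_leq_size uT TV; have := allP ml m mms; rewrite /= => l1 l2.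
by have := leq_trans sT (leq_trans l2 l1); rewrite ltnn.
Qed.

(** * Sums over small subsets *)

Lemma mem_subsets r k S : S \in subsets r k ->
  [/\ (size S <= r)%N, all (gtn k) S & uniq S].
Proof.
elim: r k S => [|r IH] k S /=; first by rewrite inE => /eqP ->.
rewrite inE => /predU1P [-> //|/flattenP [Ss /mapP [j]]].
rewrite mem_iota add0n => /andP [_ jk] -> /mapP [S' /IH [sS aS uS] ->] /=.
split=> //; rewrite ?jk ?uS ?andbT.
  by apply: sub_all aS => i /= ij; exact: ltn_trans jk.
by apply/negP => /(allP aS) /=; rewrite ltnn.
Qed.

Lemma subsetsS r k :
  subsets r.+1 k = [::] :: flatten [seq map (cons j) (subsets r j) | j <- iota 0 k].
Proof. by []. Qed.

(** The new maximum [k] is either absent from [S] or its first element. *)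
Lemma sum_subsetsS r k (h : seq nat -> int) :
  \sum_(S <- subsets r.+1 k.+1) h S =
  \sum_(S <- subsets r.+1 k) h S + \sum_(S <- subsets r k) h (k :: S).
Proof.
have iS : iota 0 k.+1 = iota 0 k ++ [:: k] by rewrite -(addn1 k) iotaD.
rewrite !subsetsS iS.
by rewrite map_cat flatten_cat !big_cons big_cat addrA /= cats0 big_map.
Qed.

Lemma sum_subsets_stable r k (h : seq nat -> int) :
  (forall S, S \in subsets r.+1 k -> (r < size S)%N -> h S = 0) ->
  \sum_(S <- subsets r.+1 k) h S = \sum_(S <- subsets r k) h S.
Proof.
elim: r k h => [|r IH] k h h0.
  rewrite /= big_cons big_seq1 big_flatten /= big_map big_seq big1 ?addr0 // => j jk.
  rewrite big_seq1 h0 //= inE; apply/orP; right; apply/flattenP.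
  by exists [:: [:: j]]; [apply/mapP; exists j | rewrite mem_head].
rewrite !(subsetsS _ k) !big_cons; congr (_ + _).
rewrite !big_flatten !big_map; apply: eq_big_seq => j jk.
rewrite !big_map; apply: (IH j (fun S => h (j :: S))) => S Sj sS.
apply: h0 => //; rewrite subsetsS inE; apply/orP; right; apply/flattenP.
by exists (map (cons j) (subsets r.+1 j)); [apply/mapP; exists j | apply: map_f].
Qed.

(** This is Newton's expansion at [U]. Splitting on whether the last position belongs to [S], the
    differences along [s k] turn the sum at [U] into the sum at [s k :: U]. *)
Lemma sum_difference D f (s : nat -> nat) k U :
  (forall T U, uniq T -> (D < size T)%N -> difference f T U = 0) ->
  {in gtn k &, injective s} ->
  \sum_(S <- subsets D k) difference f (map s S) U = f (map s (iota 0 k) ++ U).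
Proof.
(* The split lowers the size bound by one for sets containing the maximum. Raising the bound from
   [D] to [D.+1] beforehand is free, since the additional differences vanish. *)
move=> f0; have st j V : {in gtn j &, injective s} ->
    \sum_(S <- subsets D.+1 j) difference f (map s S) V =
    \sum_(S <- subsets D j) difference f (map s S) V.
  move=> sj; apply: sum_subsets_stable => S /mem_subsets [_ /allP aS uS] lS.
  apply: f0; last by rewrite size_map.
  by rewrite map_inj_in_uniq // => x y /aS xj /aS yj; exact: sj.
elim: k U => [|k IH] U sk.
  by case: (D) => [|E] /=; rewrite big_seq1.
have sk' : {in gtn k &, injective s} by move=> x y xk yk; apply: sk; exact: ltnW.
rewrite -st // sum_subsetsS st // -(addn1 k) iotaD map_cat -catA.
rewrite -[map s (iota (0 + k) 1) ++ U]/(s k :: U) -IH //.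
by rewrite -[RHS](addrNK (\sum_(S <- subsets D k) difference f (map s S) U)) addrC sumrB.
Qed.

Lemma differencesE r C c T U : (size T <= r)%N ->
  (differences r C c T U).1%:R - (differences r C c T U).2%:R =
  difference (fun U => (violations C c U)%:R) T U.
Proof.
elim: r T U => [|r IH] [|x T] U //= sT; rewrite ?subr0 //.
by rewrite -!IH // !natrD; ring.
Qed.

(** Each recursive level doubles the number of evaluations, and each evaluation counts at most
    [size c] violations. Over all slots this gives [sum_bound]. *)
Lemma differences_bound r C c T U :
  ((differences r C c T U).1 + (differences r C c T U).2 <= 2 ^ r * size c)%N.
Proof.
elim: r T U => [|r IH] T U /=; first by rewrite addn0 mul1n count_size.
case: ifP => _ /=.
  rewrite addn0; apply: leq_trans (count_size _ _) _.
  by rewrite leq_pmull // expn_gt0.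
have := IH (behead T) U; have := IH (behead T) (head 0%N T :: U).
by rewrite expnS -mulnA mul2n -addnn; lia.
Qed.

Local Close Scope ring_scope.

(** * Circuits and cliques *)

Lemma mem_assignments r n S b : size S <= r ->
  (b \in assignments r n S) = (map fst b == S) && all (fun a => a.2 < n) b.
Proof.
elim: r S b => [|r IH] [|i S] b //= sS; try by rewrite inE; case: b.
apply/allpairsP/andP => [[[x b'] [/= xn]]|].
  rewrite IH // => /andP [/eqP bS bn] -> /=; rewrite bS eqxx bn andbT.
  by move: xn; rewrite mem_iota.
case: b => [[]//|[j x] b] /= [/eqP [-> bS] /andP [xn bn]].
by exists (x, b); rewrite mem_iota IH // bS eqxx bn; split.
Qed.

Lemma agreeP v w :
  reflect (forall a b, a \in v -> b \in w -> a.1 = b.1 -> a.2 = b.2) (agree v w).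
Proof.
apply: (iffP allP) => [h a b av bw e|h a av].
  by have /allP /(_ b bw) := h a av; rewrite e eqxx => /eqP.
by apply/allP => b bw; apply/implyP => /eqP e; apply/eqP; exact: h.
Qed.

Lemma agreeC : symmetric agree.
Proof.
by move=> v w; apply/agreeP/agreeP => h a b av bw e; apply/esym/h.
Qed.

Lemma joinedC : symmetric joined.
Proof. by move=> v w; rewrite /joined eq_sym agreeC. Qed.

Lemma mem_candidates d C k (x : candidate) : x \in candidates d C k <->
  [/\ x.1.1 < size (certs d C), x.1.2 < slots d k,
      x.2.1 \in assignments (arity d) (inputs C) (nth [::] (subsets (arity d) k) x.1.2),
      x.2.2.1 <= 2 * sum_bound d C k x.1.1 & x.2.2.2 <= 2 * sum_bound d C k x.1.1].
Proof.
case: x => [[i j] [b [p q]]]; split=> [|[/= hi hj hb hp hq]].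
  move=> /flatten_mapP [i' hi] /flatten_mapP [j' hj] /flatten_mapP [b' hb].
  move=> /flatten_mapP [p' hp] /mapP [q' hq] [-> -> -> -> ->].
  by move: hi hj hp hq; rewrite !mem_iota.
apply/flatten_mapP; exists i; first by rewrite mem_iota.
apply/flatten_mapP; exists j; first by rewrite mem_iota.
apply/flatten_mapP; exists b => //.
apply/flatten_mapP; exists p; first by rewrite mem_iota.
by apply/mapP; exists q; first by rewrite mem_iota.
Qed.

Arguments slots : simpl never.
Arguments arity : simpl never.

Section Correctness.
Variables (C : circuit) (d k : nat).
Hypotheses (C_weft : weft C <= 1) (C_depth : depth C <= d).
Local Notation n := (inputs C).
Local Notation N := (inputs C + size (gates C)).
Local Notation D := (arity d).
Local Notation J := (slots d k).
Local Notation Vs := (vertices d C k).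
Let slot j := nth [::] (subsets D k) j.

Lemma slots_gt0 : 0 < J. Proof. by []. Qed.

Lemma wire_vals_tuple (a : n.-tuple bool) U :
  (forall i, i < n -> nth false a i = (i \in U)) ->
  circuit_value a = wire_val C U N.-1.
Proof.
move=> aU; rewrite /circuit_value -nth_last size_wire_values size_tuple.
rewrite /wire_val /wire_vals; congr (nth _ (wire_values _ _ _) _).
rewrite -[LHS](mkseq_nth false) size_tuple /mkseq; apply/eq_in_map => i.
rewrite mem_iota add0n => /aU ->.
by apply/idP/hasP => [iU|[j jU /eqP ->]]; first by exists i.
Qed.

Lemma certs_correct U :
  has (fun c => violations C c U == 0) (certs d C) = wire_val C U N.-1.
Proof.
rewrite certificates_correct ?out_ltn ?eqb_id // /wire_depth -longest_pathE.
exact: C_depth.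
Qed.

Lemma certs_small (c : seq (nat * bool)) x : c \in certs d C -> x \in c ->
  [/\ x.1 < N, wire_depth C x.1 <= d & wire_weft C x.1 = 0].
Proof.
apply: certificates_small; first exact: out_ltn.
  by rewrite /wire_depth -longest_pathE.
by rewrite /wire_weft -longest_pathE.
Qed.

Lemma slotP j : j < J -> [/\ size (slot j) <= D, all (gtn k) (slot j) & uniq (slot j)].
Proof. by move=> jJ; apply: mem_subsets; rewrite mem_nth. Qed.

(* The partial sums over all slots close up iff no requirement is violated. *)
Lemma balance (c : seq (nat * bool)) (s : nat -> nat) :
  c \in certs d C -> {in gtn k &, injective s} ->
  \sum_(0 <= j < J) (differences D C c (map s (slot j)) [::]).1 =
  \sum_(0 <= j < J) (differences D C c (map s (slot j)) [::]).2 +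
    violations C c (map s (iota 0 k)).
Proof.
move=> cC si.
have mv := multilinear_violations (fun x => @certs_small c x cC).
(* [D] is one more than the degree bound [2 ^ d], so there is room to spare. *)
have f0 T U : uniq T -> D < size T -> difference (fun U => (violations C c U)%:R)%R T U = 0%R.
  by move=> uT sT; apply: difference_vanish mv uT _; exact: ltnW.
have := sum_difference [::] f0 si; rewrite cats0 (big_nth [::]) -/J.
have -> : (\sum_(0 <= j < J) difference (fun U => (violations C c U)%:R) (map s (slot j)) [::] =
  \sum_(0 <= j < J) ((differences D C c (map s (slot j)) [::]).1%:R -
                     (differences D C c (map s (slot j)) [::]).2%:R))%R.
  apply: eq_big_nat => j /andP [_ /slotP [sj _ _]].
  by rewrite differencesE // size_map.
rewrite sumrB -!natr_sum !natz; lia.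
Qed.

Lemma slot_index S : S \in subsets D k -> exists2 j, j < J & slot j = S.
Proof.
by move=> SS; exists (index S (subsets D k)); [rewrite index_mem | rewrite /slot nth_index].
Qed.

Lemma singleton_slot i : i < k -> exists2 j, j < J & slot j = [:: i].
Proof.
move=> ik; apply: slot_index; rewrite subsetsS inE; apply/orP; right.
apply/flatten_mapP; exists i; first by rewrite mem_iota.
by apply: map_f; have := expn_gt0 2 d; case: (2 ^ d).
Qed.

Lemma pair_slot i1 i2 : i1 < i2 -> i2 < k -> exists2 j, j < J & slot j = [:: i2; i1].
Proof.
move=> i12 ik; apply: slot_index; rewrite subsetsS inE; apply/orP; right.
apply/flatten_mapP; exists i2; first by rewrite mem_iota.
apply: map_f; have := expn_gt0 2 d; case: (2 ^ d) => // r _.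
rewrite subsetsS inE; apply/orP; right.
apply/flatten_mapP; exists i1; first by rewrite mem_iota.
by apply: map_f; case: r.
Qed.

Lemma clique_of_assignment (a : n.-tuple bool) : count id a = k -> circuit_value a ->
  has_clique (size Vs) (fun i j => joined (nth (0, [::]) Vs i) (nth (0, [::]) Vs j)) J.
Proof.
move=> ak aC; pose U := [seq i <- iota 0 n | nth false a i].
have sU : size U = k.
  by rewrite size_filter -ak -{2}(mkseq_nth false a) size_tuple count_map; apply: eq_count.
have uU : uniq U by rewrite filter_uniq // iota_uniq.
have Un i : (i < k) -> nth 0 U i < n.
  by rewrite -sU => /(mem_nth 0); rewrite mem_filter mem_iota add0n => /andP [_ /andP []].
pose s i := nth 0 U i.
have sE : map s (iota 0 k) = U by rewrite -sU -[RHS](mkseq_nth 0).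
have si : {in gtn k &, injective s}.
  by move=> x y; rewrite !inE => xk yk /eqP; rewrite nth_uniq ?sU // => /eqP.
have : wire_val C U N.-1.
  by rewrite -(wire_vals_tuple (a := a)) // => i ni; rewrite mem_filter mem_iota /= add0n ni andbT.
rewrite -certs_correct => /hasP [c cC /eqP c0].
pose ci := index c (certs d C).
have ciE : cert_at d C ci = c by rewrite /cert_at nth_index.
pose P j := (differences D C c (map s (slot j)) [::]).1.
pose M j := (differences D C c (map s (slot j)) [::]).2.
pose B := sum_bound d C k ci.
(* By [PMb] the offset [B] dominates the subtracted sum, so the truncated subtraction is exact and
   the values lie between 0 and [2 * B]. *)
pose p j := B + \sum_(0 <= i < j) P i - \sum_(0 <= i < j) M i.
have PMb j : j <= J -> \sum_(0 <= i < j) P i + \sum_(0 <= i < j) M i <= B.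
  move=> jJ; rewrite -big_split /=.
  apply: (@leq_trans (\sum_(0 <= i < j) 2 ^ D * size c)).
    by apply: leq_sum => i _; exact: differences_bound.
  by rewrite sum_nat_const_nat subn0 /B /sum_bound ciE -mulnA leq_mul2r jJ orbT.
have pS j : j < J -> p j.+1 + M j = p j + P j.
  move=> jJ; have := PMb _ (ltnW jJ); have := PMb _ jJ.
  by rewrite /p !big_nat_recr //=; lia.
have p0 : p 0 = B by rewrite /p !big_geq // addn0 subn0.
have pJ : p J = p 0.
  by rewrite p0 /p (balance cC si) sE c0 addn0 addnK.
have pb j : j <= J -> p j <= 2 * B by move=> /PMb; rewrite /p; lia.
pose x j : candidate := ((ci, j), ([seq (i, s i) | i <- slot j], (p j, p j.+1))).
(* One global assignment of values to keys. All chosen vertices are restrictions of it, so they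
   agree pairwise. *)
pose A key := if key == 0 then ci else if key <= J then p key.-1 else s (key - J.+1).
have vA j : j < J -> all (fun a => a.2 == A a.1) (vertex d k (x j)).2.
  (* At the last slot the outgoing sum is stored under the key of the first slot, where [pJ] is
     needed. *)
  move=> jJ; rewrite /= /A /= jJ eqxx /=.
  apply/and3P; split=> //.
  - case: (eqVneq j.+1 J) => [jE|jE]; first by rewrite slots_gt0 jE pJ.
    by rewrite ltn_neqAle jE jJ.
  - rewrite !all_map; apply/allP => i _ /=.
    by rewrite leqNgt leq_addr /= addKn.
have xV j : j < J -> vertex d k (x j) \in Vs.
  move=> jJ; rewrite mem_filter; apply/andP; split.
    apply/agreeP => u v uj vj e.
    by rewrite (eqP (allP (vA j jJ) u uj)) (eqP (allP (vA j jJ) v vj)) e.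
  apply: map_f; rewrite mem_filter; apply/andP; split.
    rewrite /valid /= ciE -map_comp -/(M j) -/(P j) pS // eqxx andbT.
    have [_ /allP sk _] := slotP jJ.
    apply/allP => _ /mapP [u uj ->]; apply/allP => _ /mapP [v vj ->] /=.
    by apply/implyP => /eqP /si -> //; exact: sk.
  have [sj /allP sk _] := slotP jJ.
  have xb : (x j).2.1 \in assignments D n (slot j).
    rewrite mem_assignments // -map_comp map_id eqxx /=.
    by rewrite all_map; apply/allP => i /sk; exact: Un.
  apply/mem_candidates; split=> //; first by rewrite index_mem.
  - by apply: pb; exact: ltnW.
  - exact: pb.
pose f j := index (vertex d k (x j)) Vs.
have fE j : j < J -> nth (0, [::]) Vs (f j) = vertex d k (x j).
  by move=> jJ; rewrite nth_index // xV.
have fJ : {in iota 0 J &, injective f}.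
  move=> i j; rewrite !mem_iota /= !add0n => iJ jJ e.
  by have := fE j jJ; rewrite -e fE // => -[].
exists (map f (iota 0 J)); split.
- by rewrite map_inj_in_uniq ?iota_uniq.
- by rewrite all_map; apply/allP => j; rewrite mem_iota /= add0n index_mem => /xV.
- by rewrite size_map size_iota.
move=> _ _ /mapP [i iJ ->] /mapP [j jJ ->] ne.
have ij : i != j by apply: contraNneq ne => ->.
move: iJ jJ; rewrite !mem_iota /= !add0n => iJ jJ.
rewrite !fE //; apply/andP; split; [exact: ij | apply/agreeP => u v ui vj e].
by rewrite (eqP (allP (vA i iJ) u ui)) (eqP (allP (vA j jJ) v vj)) e.
Qed.

Lemma assignment_of_clique :
  has_clique (size Vs) (fun i j => joined (nth (0, [::]) Vs i) (nth (0, [::]) Vs j)) J ->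
  exists a : n.-tuple bool, count id a = k /\ circuit_value a.
Proof.
move=> [cl [ucl clV clJ adj]].
pose cands := [seq x <- candidates d C k | valid d C x].
pose ws := map (nth (0, [::]) Vs) cl.
have wsV w : w \in ws -> w \in Vs.
  by move=> /mapP [i icl ->]; apply: mem_nth; exact: (allP clV).
have VsP w : w \in Vs -> agree w.2 w.2 /\ exists2 x, x \in cands & w = vertex d k x.
  by rewrite mem_filter => /andP [-> /mapP].
have agr v w : v \in ws -> w \in ws -> agree v.2 w.2.
  move=> vw ww; have [e|ne] := eqVneq v w; first by rewrite e; have [] := VsP w (wsV w ww).
  move: vw ww ne => /mapP [i icl ->] /mapP [j jcl ->] ne.
  have ij : i != j by apply: contraNneq ne => ->.
  by have /andP [] := adj i j icl jcl ij.
have uws : uniq (map fst ws).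
  rewrite -map_comp map_inj_in_uniq // => i j icl jcl /= e.
  apply/eqP; apply: contraT => /(adj i j icl jcl) /andP []; by rewrite e eqxx.
(* The slots of the clique are distinct and at least [J] in number, so every slot occurs. *)
have memJ : map fst ws =i iota 0 J.
  have sub : {subset map fst ws <= iota 0 J}.
    move=> y /mapP [w /wsV /VsP [_ [x]]]; rewrite mem_filter => /andP [_ xc] -> ->.
    by have [_ xJ _ _ _] := (mem_candidates d C k x).1 xc; rewrite mem_iota.
  have sz : size (iota 0 J) <= size (map fst ws) by rewrite size_iota !size_map.
  by have [] := uniq_min_size uws sub sz.
have ex j : j < J -> exists2 x, x \in cands & vertex d k x \in ws /\ x.1.2 = j.
  move=> jJ; have : j \in map fst ws by rewrite memJ mem_iota.
  move=> /mapP [w ww ->]; have [_ [x xc xE]] := VsP w (wsV w ww).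
  by exists x => //; rewrite xE in ww *.
pose xs := [seq x <- cands | vertex d k x \in ws].
pose x0 : candidate := ((0, 0), ([::], (0, 0))).
(* A candidate in the clique with slot [j]; the default [x0] is not reached for [j < J]. *)
pose x j := nth x0 xs (index j [seq y.1.2 | y <- xs]).
have xP j : j < J -> [/\ x j \in cands, vertex d k (x j) \in ws & (x j).1.2 = j].
  move=> /ex [y yc [yw yj]].
  have yx : j \in [seq y.1.2 | y <- xs].
    by rewrite -yj; apply: (map_f (fun y : candidate => y.1.2)); rewrite mem_filter yw.
  have ix : index j [seq y.1.2 | y <- xs] < size xs.
    by rewrite -(size_map (fun y : candidate => y.1.2)) index_mem.
  have : x j \in xs by exact: mem_nth.
  rewrite mem_filter => /andP [xw xc]; split=> //.
  by rewrite /x -(nth_map x0 0 (fun y : candidate => y.1.2)) // nth_index.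
have key i j u v : i < J -> j < J -> u \in (vertex d k (x i)).2 ->
    v \in (vertex d k (x j)).2 -> u.1 = v.1 -> u.2 = v.2.
  move=> /xP [_ wi _] /xP [_ wj _]; exact: (agreeP _ _ (agr _ _ wi wj)).
(* The certificate of slot 0; key 0 makes all the other slots use the same one. *)
pose e := (x 0).1.1.
have xe j : j < J -> (x j).1.1 = e.
  by move=> jJ; apply: (key j 0 (0, (x j).1.1) (0, e)) => //; rewrite mem_head.
have xc j : j < J -> (x j) \in candidates d C k /\ valid d C (x j).
  by move=> /xP []; rewrite mem_filter => /andP [].
have bP j : j < J -> map fst (x j).2.1 = slot j /\ all (fun a => a.2 < n) (x j).2.1.
  move=> jJ; have [/mem_candidates [_ _ + _ _] _] := xc j jJ; have [_ _ ->] := xP j jJ.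
  by have [sj _ _] := slotP jJ; rewrite mem_assignments // => /andP [/eqP].
(* The value of position [i] is read off the slot consisting of [i] alone; key [J.+1 + i] carries it
   to every slot containing [i]. *)
pose s i := (head (0, 0) (x (index [:: i] (subsets D k))).2.1).2.
have bs j i y : j < J -> (i, y) \in (x j).2.1 -> y = s i.
  move=> jJ iy.
  have ik : i < k.
    have [_ /allP sk _] := slotP jJ; apply: sk; rewrite -(bP j jJ).1.
    exact: (map_f fst iy).
  have [j' jJ' sj] := singleton_slot ik.
  have j'E : index [:: i] (subsets D k) < J.
    by rewrite index_mem -sj mem_nth.
  have [] := bP _ j'E; rewrite /slot nth_index -?index_mem //.
  have -> : s i = (head (0, 0) (x (index [:: i] (subsets D k))).2.1).2 by [].
  case bE: (x _).2.1 => [|[i' z] [|]] //= [iE] _; rewrite iE in bE.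
  apply: (key _ _ (J.+1 + i, y) (J.+1 + i, z) jJ j'E) => //.
    rewrite /= !inE; do 3!(apply/orP; right).
    by apply/mapP; exists (i, y).
  rewrite /= !inE; do 3!(apply/orP; right).
  by apply/mapP; exists (i, z); rewrite // bE mem_head.
have bE j : j < J -> [seq a.2 | a <- (x j).2.1] = map s (slot j).
  move=> jJ; rewrite -(bP j jJ).1 -map_comp; apply/eq_in_map => -[i y] iy /=.
  exact: bs iy.
have sn i : i < k -> s i < n.
  move=> /singleton_slot [j jJ sj]; have [] := bP j jJ; have := bE j jJ; rewrite sj.
  by case: (x j).2.1 => [|a [|]] //= [<-] _ /andP [].
(* Both positions lie in a common slot, where validity forbids equal values. *)
have slt i1 i2 : i1 < i2 -> i2 < k -> s i1 != s i2.
  move=> i12 /(pair_slot i12) [j jJ sj].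
  have [_ /andP [/allP h _]] := xc j jJ.
  have inj a b : a \in (x j).2.1 -> b \in (x j).2.1 -> a.2 = b.2 -> a.1 = b.1.
    by move=> /h /allP hb /hb /implyP hab /eqP /hab /eqP.
  have [] := bP j jJ; have := bE j jJ; rewrite sj.
  case: (x j).2.1 inj {h} => [|a [|b [|]]] //= inj [<- <-] [fa fb] _.
  apply/eqP => ab; have := inj a b; rewrite !inE !eqxx orbT ab fa fb => /(_ isT isT erefl) ee.
  by rewrite ee ltnn in i12.
have si : {in gtn k &, injective s}.
  move=> i1 i2; rewrite !inE => k1 k2 sE; case: (ltngtP i1 i2) => // lt.
    by have := slt _ _ lt k2; rewrite sE eqxx.
  by have := slt _ _ lt k1; rewrite sE eqxx.
pose c := cert_at d C e.
have cC : c \in certs d C.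
  by apply: mem_nth; have [/mem_candidates []] := xc 0 slots_gt0.
have step j : j < J -> (x j).2.2.2 + (differences D C c (map s (slot j)) [::]).2 =
    (x j).2.2.1 + (differences D C c (map s (slot j)) [::]).1.
  by move=> jJ; have [_ /andP [_ /eqP]] := xc j jJ; rewrite xe // bE.
(* Each outgoing sum equals, through their shared key, the incoming sum of the cyclically next slot,
   so the two totals differ only by a rotation. *)
have cyc : \sum_(0 <= j < J) (x j).2.2.2 = \sum_(0 <= j < J) (x j).2.2.1.
  have next j j' : j < J -> j' < J -> j' = (if j.+1 == J then 0 else j.+1) ->
      (x j).2.2.2 = (x j').2.2.1.
    move=> jJ jJ' jE; apply: (key j j' (j'.+1, _) (j'.+1, _)) => //.
      by rewrite /= !inE; have [_ _ ->] := xP j jJ; rewrite -jE eqxx !orbT.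
    by rewrite /= !inE; have [_ _ ->] := xP j' jJ'; rewrite eqxx !orbT.
  have [J' JE] : exists J', J = J'.+1 by exists J.-1; rewrite prednK.
  rewrite JE big_nat_recr // big_nat_recl //= addnC (next J' 0) ?JE ?eqxx //.
  congr (_ + _); apply: eq_big_nat => j /andP [_ jJ']; apply: next; rewrite ?JE //.
    exact: ltnW.
  by rewrite eqSS ltn_eqF.
have viol0 : violations C c (map s (iota 0 k)) = 0.
  have := balance cC si; have sumE :
    \sum_(0 <= j < J) ((x j).2.2.2 + (differences D C c (map s (slot j)) [::]).2) =
    \sum_(0 <= j < J) ((x j).2.2.1 + (differences D C c (map s (slot j)) [::]).1).
    by apply: eq_big_nat => j /andP [_]; exact: step.
  by move: sumE; rewrite !big_split /= cyc; lia.
pose U := map s (iota 0 k).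
have outU : wire_val C U N.-1.
  by rewrite -certs_correct; apply/hasP; exists c => //; apply/eqP.
exists [tuple of map (mem U) (iota 0 n)]; split.
  rewrite /= count_map count_mem_iota ?size_map ?size_iota //.
    rewrite map_inj_in_uniq ?iota_uniq // => i j; rewrite !mem_iota !add0n; exact: si.
  by rewrite all_map; apply/allP => i; rewrite mem_iota add0n; exact: sn.
rewrite (@wire_vals_tuple _ U) // => i ni.
by rewrite /= (nth_map 0) ?size_iota // nth_iota.
Qed.

End Correctness.

(** * The complete reduction *)

Definition joined_at (Vs : seq (nat * seq (nat * nat))) : rel nat :=
  fun i j => joined (nth (0, [::]) Vs i) (nth (0, [::]) Vs j).

Lemma polytime_gadget (E : enctype) (Vs : E -> seq (nat * seq (nat * nat))) :
  polytime Vs ->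
  polytime (fun e => (size (Vs e) + size (Vs e),
                      (3, gadget_list (size (Vs e)) (joined_at (Vs e))))).
Proof.
move=> pV; rewrite /gadget_list /gadget_times /gadget_edge /joined_at.
have pV' (A : enctype) (f : A -> E) : polytime f -> polytime (fun a => Vs (f a)).
  exact: polytime_comp.
by polytime; try apply: polytime_joined; polytime; apply: pV'; polytime.
Qed.

Lemma slots_leq d : {homo slots d : k1 k2 / k1 <= k2}.
Proof.
move=> k1 k2 k12; rewrite /slots /arity !subsetsS /= ltnS.
by rewrite -(subnKC k12) iotaD map_cat flatten_cat size_cat leq_addr.
Qed.

(** [Y] stands for either of the two questions. The new parameter is [2 * slots d k], two vertices
    of the temporal graph for each slot; as [d] is fixed by the class, it depends on [k] alone. *)
Lemma W_hard_gadget (Y : tdigraph -> nat -> Prop) :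
  (forall n r m, symmetric r -> Y (gadget n r) (2 * m) <-> has_clique n r m) ->
  W_hard 1 (@restrict (PProblem enc_tdigraph Y) (fun G : tdigraph => lifetime G = 3)).
Proof.
move=> Ygadget A [d]; set S := fun C : circuit => _.
pose G C k := gadget (size (vertices d C k)) (joined_at (vertices d C k)).
pose f (C : inst (@restrict weighted_circuit_sat S)) k :
  inst (@restrict (PProblem enc_tdigraph Y) (fun G => lifetime G = 3)) :=
  exist _ (G (sval C) k) erefl.
have pg : polytime (fun k => 2 * slots d k).
  by polytime; apply: polytime_slots; polytime.
apply: (fpt_reducible_polytime (f := f)) pg _ _.
- pose raw (x : circuit * nat) :=
    ((size (vertices d x.1 x.2) + size (vertices d x.1 x.2),
      (3, gadget_list (size (vertices d x.1 x.2)) (joined_at (vertices d x.1 x.2)))),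
     2 * slots d x.2).
  pose h (x : inst_enctype (@restrict weighted_circuit_sat S) * nat) : circuit * nat :=
    (sval x.1, x.2).
  (* Circuits and graphs under a restriction are encoded like the underlying objects, so a program
     for plain lists serves unchanged. *)
  apply: (@polytime_recode _ _ _ _ raw _ h) => [[C k]|[C k]|] //.
    by apply: (congr1 (Node^~ _)); exact/esym/enc_gadget.
  apply: polytime_pair; last by polytime; apply: polytime_slots; polytime.
  by apply: polytime_gadget; apply: polytime_vertices; polytime.
- by move=> k1 k2 /(slots_leq d); rewrite leq_mul2l => ->.
- move=> [C [Cw Cd]] k /=; rewrite /G Ygadget => [|i j]; last exact: joinedC.
  split=> [[a [ak aC]]|cl]; first exact: (clique_of_assignment Cw Cd ak aC).
  exact: (assignment_of_clique Cw Cd cl).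
Qed.

Theorem theorem7 :
  W_hard 1 (@restrict closed_TCC_problem (fun G : tdigraph => lifetime G = 3)) /\
  W_hard 1 (@restrict closed_TUCC_problem (fun G : tdigraph => lifetime G = 3)).
Proof.
split.
- by apply: W_hard_gadget => n r m; exact: closed_TCC_gadget.
- by apply: W_hard_gadget => n r m; exact: closed_TUCC_gadget.
Qed.
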